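(* Let $W$ be an irreducible transition matrix on a finite set $\mathcal X$, let $g_1,\dots,g_d$ be linearly independent under $W$, and let $\{W_{\vec\theta}\}_{\vec\theta\in\mathbb R^d}$ be the exponential family of transition matrices generated by $W$ with the generator $\{g_1,\dots,g_d\}$, with potential function $\phi$ and expectation parameter $\vec\eta(\vec\theta)$. Suppose that $X^{n+1}=(X_{n+1},\dots,X_1)$ is distributed according to $W_{\vec\theta}^{\times n}\times\overline P^1_{\vec\theta}$, where $\overline P^1_{\vec\theta}$ is the stationary distribution of $W_{\vec\theta}$. Then for every $n$ and $\vec\theta$ $$\mathsf E_{\vec\theta}\Bigl[\frac{\vec g^{\,n}(X^{n+1})}{n}\Bigr]=\vec\eta(\vec\theta),$$ and, as $n\to\infty$, $$\mathsf{Cov}_{\vec\theta}\Bigl[\frac{\vec g^{\,n}(X^{n+1})}{n}\Bigr]=\frac{\mathsf H_{\vec\theta}[\phi]}{n}+o\Bigl(\frac1n\Bigr).$$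
   Context: A transition matrix on a finite set $\mathcal X$ is a nonnegative matrix $W(x|x')$ with $\sum_x W(x|x')=1$ for every $x'$; $\mathcal X^2_W:=\{(x,x'):W(x|x')>0\}$. It acts on column vectors by $v\mapsto\sum_{x'}W(x|x')v(x')$. $W$ is irreducible if for all $x,x'$ there is $n$ with $W^n(x|x')>0$. Functions $g_1,\dots,g_d:\mathcal X\times\mathcal X\to\mathbb R$ are linearly independent under $W$ if for no non-zero $(c_1,\dots,c_d)\in\mathbb R^d$ do there exist $f:\mathcal X\to\mathbb R$ and $c\in\mathbb R$ with $\sum_j c_jg_j(x,x')=f(x)-f(x')+c$ for all $(x,x')\in\mathcal X_W^2$. Exponential family: for $\vec\theta\in\mathbb R^d$ let $\overline W_{\vec\theta}(x|x'):=W(x|x')e^{\sum_j\theta^jg_j(x,x')}$, let $\lambda_{\vec\theta}$ be its Perron–Frobenius eigenvalue, $\phi(\vec\theta):=\log\lambda_{\vec\theta}$ (potential function), and $\overline P^3_{\vec\theta}$ the positive Perron–Frobenius eigenvector of $\overline W_{\vec\theta}^T$. Put $W_{\vec\theta}(x|x'):=\lambda_{\vec\theta}^{-1}\overline P^3_{\vec\theta}(x)\overline W_{\vec\theta}(x|x')\overline P^3_{\vec\theta}(x')^{-1}$. $\mathsf H_{\vec\theta}[\phi]$ is the Hesse matrix of $\phi$ at $\vec\theta$ and $\eta_j(\vec\theta):=\frac{\partial\phi}{\partial\theta^j}(\vec\theta)$. $W_{\vec\theta}^{\times n}\times\overline P^1_{\vec\theta}(x_{n+1},\dots,x_1):=W_{\vec\theta}(x_{n+1}|x_n)\cdots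 W_{\vec\theta}(x_2|x_1)\overline P^1_{\vec\theta}(x_1)$. $\vec g^{\,n}(X^{n+1}):=(g_j^n(X^{n+1}))_j$ with $g_j^n(X^{n+1}):=\sum_{i=1}^n g_j(X_{i+1},X_i)$. $\mathsf E_{\vec\theta}$ and $\mathsf{Cov}_{\vec\theta}$ denote expectation and covariance matrix under this distribution. *)

(* Defs.v *)
From HB Require Import structures.
From mathcomp Require Import all_boot all_order all_algebra.
From mathcomp Require Import complex.
From mathcomp Require Import all_classical all_reals all_analysis.

Set Implicit Arguments.
Unset Strict Implicit.
Unset Printing Implicit Defensive.

Import Order.TTheory GRing.Theory Num.Theory.
Import numFieldNormedType.Exports.

Local Open Scope classical_set_scope.
Local Open Scope ring_scope.

(* A square matrix indexed by a finite set X is a function A : X -> X -> R;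
   A x x' stands for A(x|x'), so the second argument is the departure state. *)

Definition transition_matrix (R : realType) (X : finType) (W : X -> X -> R) :=
  (forall x x', 0 <= W x x') /\ (forall x', \sum_x W x x' = 1).

Definition mx_of (R : realType) (X : finType) (A : X -> X -> R) : 'M[R]_#|X| :=
  \matrix_(i, j) A (enum_val i) (enum_val j).

Definition transpose (R : realType) (X : finType) (A : X -> X -> R) : X -> X -> R :=
  fun x x' => A x' x.

Definition apply_col (R : realType) (X : finType) (A : X -> X -> R)
  (v : X -> R) : X -> R := fun x => \sum_x' A x x' * v x'.

Definition irreducible (R : realType) (X : finType) (W : X -> X -> R) :=
  forall x x' : X, exists n : nat,
    0 < (mx_of W ^+ n) (enum_rank x) (enum_rank x').

Definition lin_indep_under (R : realType) (X : finType) (d : nat)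
    (W : X -> X -> R) (g : 'I_d -> X -> X -> R) :=
  forall a : 'rV[R]_d, a != 0 ->
    ~ exists (f : X -> R) (c : R), forall x x' : X, 0 < W x x' ->
        \sum_j a 0 j * g j x x' = f x - f x' + c.

(* The Perron-Frobenius eigenvalue is the real eigenvalue that dominates the
   modulus of every complex eigenvalue; there is at most one such real. *)
Definition is_PF_eigenvalue (R : realType) (X : finType) (A : X -> X -> R)
    (r : R) :=
  eigenvalue (mx_of A) r /\
  forall z : R[i], eigenvalue (map_mx (real_complex R) (mx_of A)) z ->
    `|z| <= real_complex R r.

Definition PF_eigenvalue (R : realType) (X : finType) (A : X -> X -> R) : R :=
  xget 0 [set r | is_PF_eigenvalue A r].

(* For irreducible A this is unique up to a positive factor, and the choice of
   factor cancels in [exp_family]. *)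
Definition PF_eigenvector (R : realType) (X : finType) (A : X -> X -> R) :
    X -> R :=
  xget (fun=> 0) [set v | (forall x, 0 < v x) /\
    forall x, apply_col A v x = PF_eigenvalue A * v x].

Definition tilted (R : realType) (X : finType) (d : nat) (W : X -> X -> R)
    (g : 'I_d -> X -> X -> R) (theta : 'rV[R]_d) : X -> X -> R :=
  fun x x' => W x x' * expR (\sum_j theta 0 j * g j x x').

Definition potential (R : realType) (X : finType) (d : nat) (W : X -> X -> R)
    (g : 'I_d -> X -> X -> R) (theta : 'rV[R]_d) : R :=
  ln (PF_eigenvalue (tilted W g theta)).

Definition exp_family (R : realType) (X : finType) (d : nat) (W : X -> X -> R)
    (g : 'I_d -> X -> X -> R) (theta : 'rV[R]_d) : X -> X -> R :=
  let P3 := PF_eigenvector (transpose (tilted W g theta)) in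
  fun x x' => (PF_eigenvalue (tilted W g theta))^-1 * P3 x *
              tilted W g theta x x' * (P3 x')^-1.

Definition pderive (R : realType) (d : nat) (j : 'I_d) (f : 'rV[R]_d -> R)
    (theta : 'rV[R]_d) : R :=
  'D_(delta_mx 0 j) f theta.

Definition hessian (R : realType) (d : nat) (f : 'rV[R]_d -> R)
    (theta : 'rV[R]_d) : 'M[R]_d :=
  \matrix_(j, k) pderive j (pderive k f) theta.

Definition expectation_param (R : realType) (X : finType) (d : nat)
    (W : X -> X -> R) (g : 'I_d -> X -> X -> R) (theta : 'rV[R]_d) :
    'rV[R]_d :=
  \row_j pderive j (potential W g) theta.

Definition stationary (R : realType) (X : finType) (W : X -> X -> R) : X -> R :=
  xget (fun=> 0) [set p | [/\ forall x, 0 <= p x, \sum_x p x = 1 &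
    forall x, apply_col W p x = p x]].

(* A trajectory (x_1, ..., x_{n+1}) is w : {ffun 'I_n.+1 -> X} with
   x_{i+1} = w i; its i-th step, i : 'I_n, goes from [source w i] = x_{i+1}
   to [target w i] = x_{i+2}. *)
Definition source (X : finType) (n : nat) (w : {ffun 'I_n.+1 -> X}) (i : 'I_n) :=
  w (widen_ord (leqnSn n) i).

Definition target (X : finType) (n : nat) (w : {ffun 'I_n.+1 -> X}) (i : 'I_n) :=
  w (lift ord0 i).

Definition markov_law (R : realType) (X : finType) (W : X -> X -> R)
    (p : X -> R) (n : nat) (w : {ffun 'I_n.+1 -> X}) : R :=
  (\prod_(i < n) W (target w i) (source w i)) * p (w ord0).

Definition path_sum (R : realType) (X : finType) (d : nat)
    (g : 'I_d -> X -> X -> R) (n : nat) (w : {ffun 'I_n.+1 -> X}) : 'rV[R]_d :=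
  \row_j \sum_(i < n) g j (target w i) (source w i).

Definition mean (R : realType) (T : finType) (d : nat) (P : T -> R)
    (F : T -> 'rV[R]_d) : 'rV[R]_d :=
  \sum_t P t *: F t.

Definition cov_mx (R : realType) (T : finType) (d : nat) (P : T -> R)
    (F : T -> 'rV[R]_d) : 'M[R]_d :=
  \matrix_(j, k) \sum_t P t * ((F t - mean P F) 0 j * (F t - mean P F) 0 k).

Definition stationary_law (R : realType) (X : finType) (d : nat)
    (W : X -> X -> R) (g : 'I_d -> X -> X -> R) (theta : 'rV[R]_d) (n : nat)
    (w : {ffun 'I_n.+1 -> X}) : R :=
  markov_law (exp_family W g theta) (stationary (exp_family W g theta)) w.

Arguments stationary_law {R X d} W g theta n _.

Definition empirical_mean (R : realType) (X : finType) (d : nat)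
    (g : 'I_d -> X -> X -> R) (n : nat) (w : {ffun 'I_n.+1 -> X}) : 'rV[R]_d :=
  n%:R^-1 *: path_sum g w.

Arguments empirical_mean {R X d} g n _.

(* Main.v *)
Require Import Defs.
From mathcomp Require Import all_boot all_order all_algebra.
From mathcomp Require Import all_classical all_reals all_analysis.
From mathcomp Require Import complex ring lra.
Import Order.TTheory GRing.Theory Num.Theory.
Import numFieldNormedType.Exports.
Local Open Scope classical_set_scope.
Local Open Scope ring_scope.

Set Implicit Arguments.
Unset Strict Implicit.
Unset Printing Implicit Defensive.

(* Fix theta and write P for W_theta and p for its stationary law. Moving theta
   by h along the j-th axis tilts P by exp (h g_j). The left Perron vector w_h of
   the tilted matrix, normalized by p, stays bounded, so inverting the bordered
   matrix 1 - P + p 1^T shows that w_h and the eigenvalue are differentiable at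
   h = 0. Hence the j-th partial derivative of phi is the stationary mean eta_j
   of g_j, and P is differentiable with logarithmic derivative
     m_j(x, y) = g_j(x, y) - eta_j + f_j(x) - f_j(y),
   where f_j is the derivative of log w_h. As P stays stochastic,
   sum_x P(x|y) m_j(x, y) = 0. Stationarity lets one replace g_k - eta_k by m_k
   in the mean, and differentiating again gives the Hessian
     H_jk = sum_(x, y) P(x|y) p(y) m_j(x, y) m_k(x, y).
   Finally g_j^n - n eta_j is the martingale with increments m_j plus a bounded
   boundary term. The martingales have covariance exactly n H_jk, and by AM-GM the
   boundary terms contribute o(n). *)

(** * Irreducibility as connectedness of the support *)

(* Irreducibility depends on the support only and is preserved by transposition
   and by positive rescaling of the entries; this form makes both evident. *)
Definition connected_support (R : realType) (X : finType) (A : X -> X -> R) :=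
  forall Q : pred X, (forall x x', 0 < A x x' -> Q x' -> Q x) ->
  forall x x', Q x' -> Q x.

(** By nonnegativity, a positive entry of [mx_of A ^+ n] has a positive term in its first-step
    expansion; [Q] is pulled back through that step by induction on [n]. *)
Lemma irreducible_connected (R : realType) (X : finType) (A : X -> X -> R) :
  (forall x x', 0 <= A x x') -> irreducible A -> connected_support A.
Proof.
move=> A0 irr Q cl x x'; have [n] := irr x x'.
have E0 k i j : 0 <= (mx_of A ^+ k) i j.
  elim: k i j => [|k IH] i j; first by rewrite expr0 mxE; case: eqP.
  rewrite exprS mxE sumr_ge0 // => l _; rewrite mulr_ge0 // ?IH //.
  by rewrite mxE A0.
elim: n x => [|n IH] x.
  rewrite expr0 mxE; case: eqP => [/enum_rank_inj -> //|_].
  by rewrite mulr0n ltxx.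
rewrite exprS mxE => h qx'.
case: (@psumr_neq0P R _ predT
    (fun l => mx_of A (enum_rank x) l * (mx_of A ^+ n) l (enum_rank x'))).
- by move=> l _; rewrite mulr_ge0 // mxE.
- by apply/eqP; rewrite gt_eqF.
move=> l /=.
have := E0 n l (enum_rank x'); rewrite le_eqVlt => /orP[/eqP<-|lt0].
  by rewrite mulr0 ltxx.
rewrite pmulr_lgt0 // mxE enum_rankK => lt1.
by apply: (cl _ _ lt1); apply: IH; rewrite ?enum_valK.
Qed.

(** The complement of a set closed under the transposed steps is closed under the steps of [A], so a
    point outside [Q] would force [x'] outside [Q]. *)
Lemma connected_support_transpose (R : realType) (X : finType)
    (A : X -> X -> R) :
  connected_support A -> connected_support (transpose A).
Proof.
move=> cA Q cl x x' qx'; case: (boolP (Q x)) => // nqx.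
suff: predC Q x' by rewrite /= qx'.
apply: (cA (predC Q) _ x' x nqx) => y y' Ayy' /=.
by apply: contra => qy; apply: (cl y' y).
Qed.

Lemma connected_support_sub (R : realType) (X : finType) (A B : X -> X -> R) :
  (forall x x', 0 < A x x' -> 0 < B x x') ->
  connected_support A -> connected_support B.
Proof. by move=> AB cA Q cl; apply: cA => x x' /AB; apply: cl. Qed.

(** * Perron-Frobenius theory *)

Lemma apply_col_gt0 (R : realType) (X : finType) (A : X -> X -> R)
    (v : X -> R) x x' :
  (forall x x', 0 <= A x x') -> (forall x, 0 <= v x) ->
  0 < A x x' -> 0 < v x' -> 0 < apply_col A v x.
Proof.
move=> A0 v0 Ap vp; rewrite /apply_col (bigD1 x') //= ltr_pwDl ?mulr_gt0 //.
by rewrite sumr_ge0 // => y _; rewrite mulr_ge0.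
Qed.

(** The set where [v] is positive is closed under the steps of [A]: where [v] vanishes, the
    eigenvalue equation makes [apply_col A v] vanish too, which excludes a step from a positive
    coordinate. *)
Lemma nonneg_eigenvector_gt0 (R : realType) (X : finType) (A : X -> X -> R)
    (r : R) (v : X -> R) :
  (forall x x', 0 <= A x x') -> connected_support A ->
  (forall x, 0 <= v x) -> (forall x, apply_col A v x = r * v x) ->
  (exists x, v x != 0) -> forall x, 0 < v x.
Proof.
move=> A0 cA v0 Av [x0 vx0] x.
apply: (cA (fun x => 0 < v x) _ x x0); last by rewrite lt_neqAle eq_sym vx0 v0.
move=> y y' Ayy' vy'; rewrite lt_neqAle v0 andbT eq_sym; apply/eqP => vy.
have := @apply_col_gt0 _ _ A v y y' A0 v0 Ayy' vy'.
by rewrite Av vy mulr0 ltxx.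
Qed.

(** Subtracting from [q] the largest multiple of [v] that keeps the difference nonnegative leaves a
    nonnegative eigenvector with a zero coordinate, at the minimizer of [q / v]; such a vector is
    zero. *)
Lemma eigenvector_proportional (R : realType) (X : finType) (A : X -> X -> R)
    (r : R) (v q : X -> R) :
  (forall x x', 0 <= A x x') -> connected_support A ->
  (forall x, 0 < v x) -> (forall x, apply_col A v x = r * v x) ->
  (forall x, apply_col A q x = r * q x) ->
  exists c, forall x, q x = c * v x.
Proof.
move=> A0 cA v0 Av Aq; have [x0 _|X0] := pickP (@predT X); last first.
  by exists 0 => x; have := X0 x.
pose x1 := [arg min_(y < x0) (q y / v y)]%O.
have x1P y : q x1 / v x1 <= q y / v y.
  by rewrite /x1; case: arg_minP => // i _; apply.
exists (q x1 / v x1).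
suff h x : q x - (q x1 / v x1) * v x == 0 by move=> x; apply/eqP; rewrite -subr_eq0 h.
apply/negPn/negP => hx.
have := @nonneg_eigenvector_gt0 R X A r (fun x => q x - q x1 / v x1 * v x) A0 cA.
move=> /(_ _ _ _ x1) h.
have : 0 < q x1 - q x1 / v x1 * v x1.
  apply: h; last by exists x.
    by move=> y; rewrite subr_ge0 -ler_pdivlMr.
  move=> y; have -> : r * (q y - q x1 / v x1 * v y) = r * q y - (q x1 / v x1) * (r * v y) by ring.
  rewrite -Av -Aq /apply_col mulr_sumr -sumrB; apply: eq_bigr => z _; ring.
by rewrite divfK ?gt_eqF // subrr ltxx.
Qed.

Lemma closed_preimage_ge0 (R : realType) (T : topologicalType) (f : T -> R) :
  continuous f -> closed [set t | 0 <= f t].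
Proof.
move=> fc.
exact: (proj1 (@continuous_closedP _ _ f) fc _ (@closed_ge R 0)).
Qed.

Lemma cvg_sumr (R : realType) (X : finType) (T : Type) (F : set_system T)
    (f : X -> T -> R) (a : X -> R) : Filter F ->
  (forall x, f x t @[t --> F] --> a x) ->
  \sum_x f x t @[t --> F] --> \sum_x a x.
Proof.
move=> FF fa; rewrite -(fct_sumE (index_enum X) predT f).
apply: (big_ind2 (fun (u : T -> R) v => u @ F --> v)) => [|u v u' v' uv uv'|x _].
- exact: cvg_cst.
- exact: cvgD.
- exact: fa.
Qed.

(* Collatz-Wielandt: the supremum of the [r] such that [r * v <= A v] for some
   probability vector [v] is attained by compactness. *)
Lemma collatz_wielandt_max (R : realType) (X : finType) (A : X -> X -> R) (x0 : X) :
  (forall x x', 0 <= A x x') ->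
  exists r (v : X -> R), [/\ 0 <= r, (forall x, 0 <= v x), \sum_x v x = 1,
    (forall x, r * v x <= apply_col A v x) &
    forall s (w : X -> R), (forall x, 0 <= w x) -> \sum_x w x = 1 ->
      (forall x, s * w x <= apply_col A w x) -> s <= r].
Proof.
move=> A0; set C := \sum_x \sum_x' A x x'.
have C0 : 0 <= C by rewrite sumr_ge0 // => x _; rewrite sumr_ge0.
(* Summing over all coordinates, each [w y] being at most 1, bounds every admissible [s] by the
   total [C] of the entries; the feasible set is therefore bounded. *)
have sC s (w : X -> R) : (forall x, 0 <= w x) -> \sum_x w x = 1 ->
    (forall x, s * w x <= apply_col A w x) -> s <= C.
  move=> w0 w1 sw; have -> : s = \sum_x s * w x by rewrite -mulr_sumr w1 mulr1.
  apply: ler_sum => x _; apply: (le_trans (sw x)); apply: ler_sum => y _.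
  by rewrite ler_piMr // -w1 (bigD1 y) //= lerDl sumr_ge0.
pose n := #|X|; pose T := (R * 'rV[R]_n)%type.
pose crd (p : T) x := p.2 0 (enum_rank x).
have crdc x : continuous (crd^~ x : T -> R).
  move=> p; apply: (@continuous_comp _ _ _ snd (fun M : 'rV[R]_n => M 0 (enum_rank x))).
    exact: cvg_snd.
  exact: coord_continuous.
pose K := [set p : T | [/\ 0 <= p.1, (forall x, 0 <= crd p x), \sum_x crd p x = 1 &
  forall x, p.1 * crd p x <= apply_col A (crd p) x]].
have Kcl : closed K.
  (* Each constraint becomes the preimage of a closed half-line; the mass equation is split into two
     inequalities. *)
  have -> : K = [set p | 0 <= p.1] `&` \bigcap_x [set p | 0 <= crd p x] `&`
     [set p | 0 <= \sum_x crd p x - 1] `&` [set p | 0 <= 1 - \sum_x crd p x] `&`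
     \bigcap_x [set p | 0 <= apply_col A (crd p) x - p.1 * crd p x].
    apply/seteqP; split=> p /=.
      case=> h1 h2 h3 h4; rewrite h3 subrr lexx; do ![split=> //]; move=> x _ //=.
      by rewrite subr_ge0.
    case=> [[[[h1 h2] h3] h4] h5]; split=> //.
    - by move=> x; apply: h2.
    - by apply/eqP; rewrite eq_le -subr_ge0 h4 -subr_ge0 h3.
    - by move=> x; rewrite -subr_ge0; apply: h5.
  apply: closedI; first apply: closedI; first apply: closedI; first apply: closedI.
  - by apply: closed_preimage_ge0 => p; apply: cvg_fst.
  - by apply: closed_bigI => x _; apply: closed_preimage_ge0.
  - apply: closed_preimage_ge0 => p; apply: cvgB; last exact: cvg_cst.
    by apply: (@cvg_sumr R X _ _ (fun x p => crd p x)) => x; apply: crdc.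
  - apply: closed_preimage_ge0 => p; apply: cvgB; first exact: cvg_cst.
    by apply: (@cvg_sumr R X _ _ (fun x p => crd p x)) => x; apply: crdc.
  - apply: closed_bigI => x _; apply: closed_preimage_ge0 => p; apply: cvgB.
      apply: (@cvg_sumr R X _ _ (fun y p => A x y * crd p y) (fun y => A x y * crd p y)) => y.
      by apply: cvgM; [exact: cvg_cst | exact: crdc].
    by apply: cvgM; [exact: cvg_fst | exact: crdc].
have Kco : compact K.
  apply: (@subclosed_compact _ _
    (`[0, C]%classic `*` [set v : 'rV[R]_n | forall i, `[0, 1]%classic (v ord0 i)])).
  - exact: Kcl.
  - apply: compact_setX; first exact: segment_compact.
    by apply: (@rV_compact R n (fun=> `[0, 1]%classic)) => i; apply: segment_compact.
  - move=> p [h1 h2 h3 h4]; split => /=.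
      by rewrite in_itv /= h1 (sC p.1 (crd p)).
    move=> i; have := h2 (enum_val i); rewrite /crd enum_valK /= in_itv /= => -> /=.
    rewrite -h3 (bigD1 (enum_val i)) //= {1}/crd enum_valK lerDl sumr_ge0 // => *; exact: h2.
have embed s (w : X -> R) : 0 <= s -> (forall x, 0 <= w x) -> \sum_x w x = 1 ->
    (forall x, s * w x <= apply_col A w x) -> K (s, \row_i w (enum_val i)).
  move=> s0 w0 w1 sw.
  have E : crd (s, \row_i w (enum_val i)) = w.
    by apply/funext => x; rewrite /crd mxE enum_rankK.
  by split; rewrite ?E.
case: (@compact_EVT_max _ R (fst : T -> R) K _ Kco).
(* The point mass at [x0] with [r = 0] shows that the feasible set is nonempty. *)
- exists (0, \row_i (enum_val i == x0)%:R).
  apply: (embed 0 (fun x => (x == x0)%:R)) => //.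
  + by rewrite (bigD1 x0) //= eqxx big1 ?addr0 // => y /negPf ->.
  + by move=> x; rewrite mul0r sumr_ge0 // => y _; rewrite mulr_ge0.
- by apply: continuous_subspaceT => q; apply: cvg_fst.
move=> p pK pmax.
have [h1 h2 h3 h4] := set_mem pK.
exists p.1, (crd p); split=> // s w w0 w1 sw.
have [s0|/ltW s0] := leP 0 s; last exact: le_trans h1.
exact/(pmax (s, \row_i w (enum_val i)))/mem_set/embed.
Qed.

Lemma apply_colD (R : realType) (X : finType) (A : X -> X -> R) (v w : X -> R) x :
  apply_col A (fun y => v y + w y) x = apply_col A v x + apply_col A w x.
Proof. by rewrite -big_split /=; apply: eq_bigr => y _; rewrite mulrDr. Qed.

(** The Collatz-Wielandt maximizer is an eigenvector. If its defect [A v - r v] were nonzero, a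
    power of [1 + A] would make the defect positive everywhere, and [r] could be increased. *)
Lemma perron_frobenius (R : realType) (X : finType) (A : X -> X -> R) (x0 : X) :
  (forall x x', 0 <= A x x') -> connected_support A ->
  exists r (v : X -> R),
    (forall x, 0 < v x) /\ (forall x, apply_col A v x = r * v x).
Proof.
move=> A0 cA; have [r [v [r0 v0 v1 rv rmax]]] := collatz_wielandt_max x0 A0.
pose y x := apply_col A v x - r * v x.
have [h|] := boolP [forall x, y x == 0]; last first.
  move=> /forallPn[z yz].
  pose step (u : X -> R) x := u x + apply_col A u x.
  pose it k u := iter k step u.
  have step0 u : (forall x, 0 <= u x) -> forall x, 0 <= step u x.
    by move=> u0 x; rewrite addr_ge0 // sumr_ge0 // => t _; rewrite mulr_ge0.
  have y0 x : 0 <= y x by rewrite subr_ge0.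
  have it0 u k : (forall x, 0 <= u x) -> forall x, 0 <= it k u x.
    by move=> u0; elim: k => //= k IH; apply: step0.
  have itS k u x : (forall x, 0 <= u x) -> it k u x <= it k.+1 u x.
    by move=> u0; rewrite /= lerDl sumr_ge0 // => t _; rewrite mulr_ge0 // it0.
  have itm k l u x : (forall x, 0 <= u x) -> (k <= l)%N -> it k u x <= it l u x.
    move=> u0 /subnK <-; elim: (l - k)%N => //= m IH.
    by apply: (le_trans IH); apply: itS.
  have pos x : exists k, 0 < it k y x.
    suff : `[< exists k, 0 < it k y x >] by move/asboolP.
    apply: (cA (fun x => `[< exists k, 0 < it k y x >]) _ x z).
      move=> a b Aab /asboolP[k hk]; apply/asboolP; exists k.+1 => /=.
      rewrite /step ltr_wpDl ?(it0 y k) //.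
      by apply: (apply_col_gt0 A0 _ Aab) => // t; apply: it0.
    by apply/asboolP; exists 0%N; rewrite /= lt_neqAle eq_sym yz y0.
  pose k x := projT1 (cid (pos x)).
  have kP x : 0 < it (k x) y x by rewrite /k; case: cid.
  (* Iterates of [step] increase on nonnegative vectors, so a coordinate once positive stays
     positive and the maximal time serves all of them. *)
  pose N := \max_x k x.
  have Np x : 0 < it N y x.
    by apply: (lt_le_trans (kP x)); apply: itm => //; apply: leq_bigmax.
  pose w := it N v.
  (* Iterating [step] commutes with taking the defect, since [step] is a polynomial in [A]. *)
  have wy x : it N y x = apply_col A w x - r * w x.
    rewrite /w; elim: N {Np w} x => [//|m IH] x /=; rewrite {1}/step IH /step apply_colD.
    have -> : apply_col A (it m y) x =
        apply_col A (apply_col A (it m v)) x - r * apply_col A (it m v) x.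
      rewrite /apply_col mulr_sumr -sumrB; apply: eq_bigr => t _.
      by rewrite IH /apply_col; ring.
    by rewrite mulrDr; ring.
  have w0 x : 0 <= w x by apply: it0.
  have sw : 0 < \sum_x w x.
    by apply: (@lt_le_trans _ _ 1) => //; rewrite -v1 ler_sum // => x _; apply: (itm 0).
  pose x1 := [arg min_(t < x0) it N y t]%O.
  have x1P t : it N y x1 <= it N y t by rewrite /x1; case: arg_minP => // i _; apply.
  (* No coordinate of [w] exceeds its sum, so [e * w x] is at most the least defect and [r + e] is
     admissible for the normalized [w]. *)
  pose e := it N y x1 / \sum_x w x.
  have e0 : 0 < e by rewrite divr_gt0.
  suff : r + e <= r by rewrite gerDl leNgt e0.
  apply: (rmax _ (fun x => w x / \sum_x w x)).
  - by move=> x; rewrite divr_ge0 // ltW.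
  - by rewrite -mulr_suml divff // gt_eqF.
  move=> x.
  have -> : apply_col A (fun x => w x / \sum_x w x) x = apply_col A w x / \sum_x w x.
    by rewrite /apply_col mulr_suml; apply: eq_bigr => t _; rewrite mulrA.
  rewrite mulrA ler_pM2r ?invr_gt0 // mulrDl -lerBrDl -wy.
  apply: (le_trans _ (x1P x)); rewrite /e -mulrA [_^-1 * _]mulrC ler_piMr ?(ltW (Np _)) //.
  rewrite ler_pdivrMr // mul1r (bigD1 x) //= lerDl sumr_ge0 //.
have Av x : apply_col A v x = r * v x by apply/eqP; rewrite -subr_eq0; move/forallP: h; apply.
exists r, v; split=> //; apply: nonneg_eigenvector_gt0 Av _ => //.
apply: contrapT => vz; have := oner_neq0 R; rewrite -v1 big1 ?eqxx // => x _.
by apply/eqP/negPn/negP => vx; apply: vz; exists x.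
Qed.

(** Taking moduli in the left eigenvector equation gives an entrywise inequality for [|w|]; pairing
    it with the positive right eigenvector [v] turns it into [|z| * S <= r * S] with [S > 0]. *)
Lemma eigenvalue_dominated (R : realType) (X : finType) (A : X -> X -> R)
    (r : R) (v : X -> R) :
  (forall x x', 0 <= A x x') -> (forall x, 0 < v x) ->
  (forall x, apply_col A v x = r * v x) ->
  forall z : R[i], eigenvalue (map_mx (real_complex R) (mx_of A)) z ->
    `|z| <= real_complex R r.
Proof.
move=> A0 v0 Av z /eigenvalueP[w wM w0].
pose S := \sum_j `|w 0 j| * real_complex R (v (enum_val j)).
have vC x : 0 < real_complex R (v x) by rewrite ltcR.
have S0 : 0 < S.
  have [j wj] : exists j, w 0 j != 0.
    apply: contrapT => h; case/eqP: w0; apply/rowP => j; rewrite mxE.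
    by apply/eqP/negPn/negP => wj; apply: h; exists j.
  rewrite /S (bigD1 j) //= ltr_pwDl ?mulr_gt0 ?normr_gt0 //.
  by rewrite sumr_ge0 // => k _; rewrite mulr_ge0 // ltW.
rewrite -(ler_pM2r S0).
have col j : `|z| * `|w 0 j| <= \sum_i `|w 0 i| * real_complex R (A (enum_val i) (enum_val j)).
  have := congr1 (fun M : 'rV_#|X| => M 0 j) wM; rewrite !mxE -normrM => <-.
  apply: (le_trans (ler_norm_sum _ _ _)); apply: ler_sum => i _.
  by rewrite !mxE normrM (ger0_norm (_ : 0 <= real_complex R _)) // lecR.
apply: (@le_trans _ _ (\sum_j
    (\sum_i `|w 0 i| * real_complex R (A (enum_val i) (enum_val j))) *
    real_complex R (v (enum_val j)))).
  rewrite /S mulr_sumr; apply: ler_sum => j _.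
  by rewrite mulrA ler_pM2r.
rewrite le_eqVlt; apply/orP; left; apply/eqP.
under eq_bigr do rewrite mulr_suml.
rewrite exchange_big /= /S mulr_sumr; apply: eq_bigr => i _.
under eq_bigr do rewrite -mulrA -rmorphM.
rewrite -mulr_sumr -rmorph_sum /=.
have -> : \sum_(j < #|X|) A (enum_val i) (enum_val j) * v (enum_val j) = r * v (enum_val i).
  by rewrite -Av /apply_col [RHS](reindex (@enum_val X predT)) //;
    apply: onW_bij; apply: enum_val_bij.
by rewrite rmorphM mulrCA.
Qed.

Lemma PF_eigenvalue_unique (R : realType) (X : finType) (A : X -> X -> R)
    (r s : R) : is_PF_eigenvalue A r -> is_PF_eigenvalue A s -> r = s.
Proof.
move=> [er dr] [es ds]; apply/eqP; rewrite eq_le.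
have ev t : eigenvalue (mx_of A) t ->
    eigenvalue (map_mx (real_complex R) (mx_of A)) (real_complex R t).
  move=> /eigenvalueP[w wM w0]; apply/eigenvalueP; exists (map_mx (real_complex R) w).
    by rewrite -map_mxM wM map_mxZ.
  by rewrite map_mx_eq0.
have nr t u : `|real_complex R t| <= real_complex R u -> t <= u.
  by rewrite -lecR => /(le_trans _); apply; rewrite real_ler_norm // realE !lecR le_total.
by rewrite !nr ?dr ?ds ?ev.
Qed.

(** The bilinear form of [A] at [u] and [v] equals both [r] and [s] times the positive number
    [\sum_x u x * v x]. *)
Lemma left_right_eigenvalue (R : realType) (X : finType) (A : X -> X -> R)
    (r s : R) (u v : X -> R) (x0 : X) :
  (forall x, 0 < u x) -> (forall x, 0 < v x) ->
  (forall x, apply_col (transpose A) u x = r * u x) ->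
  (forall x, apply_col A v x = s * v x) -> r = s.
Proof.
move=> u0 v0 uA Av.
have S0 : 0 < \sum_x u x * v x.
  rewrite (bigD1 x0) //= ltr_pwDl ?mulr_gt0 //.
  by rewrite sumr_ge0 // => x _; rewrite mulr_ge0 // ltW.
apply: (mulIf (lt0r_neq0 S0)); rewrite !mulr_sumr.
transitivity (\sum_x \sum_y u y * A y x * v x).
  apply: eq_bigr => x _; rewrite mulrA -uA /apply_col mulr_suml.
  by apply: eq_bigr => y _; rewrite /transpose [A y x * _]mulrC.
rewrite exchange_big /=; apply: eq_bigr => y _.
rewrite mulrCA -Av /apply_col mulr_sumr; apply: eq_bigr => x _; exact/esym/mulrA.
Qed.

(** [eigenvalue] refers to row vectors, so [u] makes [r] an eigenvalue, while [v] gives the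
    domination; uniqueness then identifies the value chosen by [xget]. *)
Lemma PF_eigenvalue_eq (R : realType) (X : finType) (A : X -> X -> R)
    (r s : R) (u v : X -> R) (x0 : X) :
  (forall x x', 0 <= A x x') ->
  (forall x, 0 < u x) -> (forall x, 0 < v x) ->
  (forall x, apply_col (transpose A) u x = r * u x) ->
  (forall x, apply_col A v x = s * v x) -> PF_eigenvalue A = r.
Proof.
move=> A0 u0 v0 uA Av; have rs := left_right_eigenvalue x0 u0 v0 uA Av; subst s.
have h : is_PF_eigenvalue A r.
  split; last exact: (eigenvalue_dominated A0 v0 Av).
  apply/eigenvalueP; exists (\row_i u (enum_val i)).
    apply/rowP => j; rewrite !mxE -uA /apply_col [RHS](reindex (@enum_val X predT)) /=.
      by apply: eq_bigr => i _; rewrite !mxE mulrC.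
    by apply: onW_bij; apply: enum_val_bij.
  apply/eqP => /rowP/(_ (enum_rank x0)); rewrite !mxE enum_rankK.
  by apply/eqP; rewrite gt_eqF.
by apply: xget_unique => // s hs; apply: PF_eigenvalue_unique hs h.
Qed.

(** [PF_eigenvector (transpose A)] is defined through the eigenvalue of the transpose. That
    eigenvalue agrees with the one of [A], and existence ensures that [xget] returns a genuine
    eigenvector rather than its default. *)
Lemma perron_pair (R : realType) (X : finType) (A : X -> X -> R) (x0 : X) :
  (forall x x', 0 <= A x x') -> connected_support A ->
  exists v, [/\ (forall x, 0 < v x),
    (forall x, apply_col A v x = PF_eigenvalue A * v x),
    (forall x, 0 < PF_eigenvector (transpose A) x) &
    (forall x, apply_col (transpose A) (PF_eigenvector (transpose A)) x =
       PF_eigenvalue A * PF_eigenvector (transpose A) x)].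
Proof.
move=> A0 cA; have cT := connected_support_transpose cA.
have T0 x x' : 0 <= transpose A x x' by apply: A0.
have [s [v [v0 Av]]] := perron_frobenius x0 A0 cA.
have [r [u [u0 uA]]] := perron_frobenius x0 T0 cT.
have e1 := PF_eigenvalue_eq x0 A0 u0 v0 uA Av.
have e2 := PF_eigenvalue_eq x0 T0 v0 u0 Av uA.
have rs := left_right_eigenvalue x0 u0 v0 uA Av; rewrite -rs in e2.
exists v; have : exists u, (forall x, 0 < u x) /\
    forall x, apply_col (transpose A) u x = PF_eigenvalue (transpose A) * u x.
  by exists u; split=> // x; rewrite e2.
move=> /(@xgetPex _ (fun=> 0)) [p1 p2].
rewrite e1; split.
- exact: v0.
- by move=> x; rewrite Av rs.
- exact: p1.
- by rewrite -e2; exact: p2.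
Qed.

Lemma PF_eigenvalue_gt0 (R : realType) (X : finType) (A : X -> X -> R) (x0 : X) :
  (forall x x', 0 <= A x x') -> connected_support A ->
  (exists x, 0 < A x x0) -> 0 < PF_eigenvalue A.
Proof.
move=> A0 cA [x1 Ax]; have [v [v0 Av u0 uA]] := perron_pair x0 A0 cA.
have := uA x0; move: (PF_eigenvector _) u0 {uA} => u u0 uA.
rewrite -(pmulr_lgt0 _ (u0 x0)) -uA.
by apply: (@apply_col_gt0 _ _ _ _ x0 x1) => // [x x'|x]; [exact: A0 | exact: ltW].
Qed.

(** * Stationary laws and the bordered matrix *)

Lemma transition_eigenvector (R : realType) (X : finType) (P : X -> X -> R) (x : X) :
  transition_matrix P -> apply_col (transpose P) (fun=> 1) x = 1 * 1.
Proof.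
move=> [_ P1]; rewrite mulr1 -[RHS](P1 x).
by apply: eq_bigr => y _; rewrite mulr1.
Qed.

(** The constant 1 is a positive left eigenvector with eigenvalue 1, so the right Perron vector also
    has eigenvalue 1 and only needs normalizing. *)
Lemma stationaryP (R : realType) (X : finType) (P : X -> X -> R) (x0 : X) :
  transition_matrix P -> connected_support P ->
  [/\ (forall x, 0 < stationary P x), \sum_x stationary P x = 1 &
    forall x, apply_col P (stationary P) x = stationary P x].
Proof.
move=> tP cP; have [P0 P1] := tP.
have [s [v [v0 Pv]]] := perron_frobenius x0 P0 cP.
have s1 : 1 = s.
  apply: (left_right_eigenvalue x0 (u := fun=> 1) _ v0 _ Pv) => // x.
  exact: transition_eigenvector.
have S0 : 0 < \sum_x v x.
  by rewrite (bigD1 x0) //= ltr_pwDl // sumr_ge0 // => x _; exact: ltW.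
have : exists p, [/\ forall x, 0 <= p x, \sum_x p x = 1 & forall x, apply_col P p x = p x].
  exists (fun x => v x / \sum_x v x); split.
  - by move=> x; rewrite divr_ge0 // ltW.
  - by rewrite -mulr_suml divff // gt_eqF.
  move=> x; transitivity (apply_col P v x / \sum_x v x); last by rewrite Pv -s1 mul1r.
  by rewrite /apply_col mulr_suml; apply: eq_bigr => y _; rewrite mulrA.
move=> /(@xgetPex _ (fun=> 0)); rewrite -/(stationary P) => -[p0 p1 pP].
split=> //; apply: (@nonneg_eigenvector_gt0 _ _ P 1) => //.
  by move=> x; rewrite mul1r; exact: pP.
apply: contrapT => vz; have := oner_neq0 R; rewrite -p1 big1 ?eqxx // => x _.
by apply/eqP/negPn/negP => vx; apply: vz; exists x.
Qed.

Definition col_of (R : realType) (X : finType) (q : X -> R) : 'cV[R]_#|X| :=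
  \col_i q (enum_val i).

Lemma col_of_inj (R : realType) (X : finType) (p q : X -> R) :
  col_of p = col_of q -> forall x, p x = q x.
Proof. by move=> /colP h x; have := h (enum_rank x); rewrite !mxE enum_rankK. Qed.

Lemma mulmx_col_of (R : realType) (X : finType) (A : X -> X -> R) (q : X -> R) :
  mx_of A *m col_of q = col_of (apply_col A q).
Proof.
apply/colP => i; rewrite !mxE /apply_col [RHS](reindex (@enum_val X predT)) /=.
  by apply: eq_bigr => j _; rewrite !mxE.
by apply: onW_bij; apply: enum_val_bij.
Qed.

Lemma trivial_kernel_inverse (R : realType) (X : finType) (K : X -> X -> R) :
  (forall q : X -> R, (forall x, apply_col K q x = 0) -> forall x, q x = 0) ->
  exists Z : X -> X -> R,
    (forall q x, apply_col Z (apply_col K q) x = q x) /\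
    (forall q x, apply_col (transpose Z) (apply_col (transpose K) q) x = q x).
Proof.
move=> ker; pose M := mx_of K.
have uM : M \in unitmx.
  rewrite unitmxE unitfE -det_tr; apply/det0P => -[w w0 wM].
  case/eqP: w0; apply/rowP => i; rewrite mxE -(enum_valK i).
  apply: (ker (fun x => w 0 (enum_rank x))) => x.
  apply: (@col_of_inj _ _ _ (fun=> 0)); rewrite -mulmx_col_of.
  have -> : col_of (fun x => w 0 (enum_rank x)) = w^T.
    by apply/colP => j; rewrite !mxE enum_valK.
  rewrite -/M -[M]trmxK -trmx_mul wM.
  by apply/colP => j; rewrite !mxE.
pose Z x y := invmx M (enum_rank x) (enum_rank y).
have ZE : mx_of Z = invmx M by apply/matrixP => i j; rewrite mxE /Z !enum_valK.
have trE (A : X -> X -> R) : mx_of (transpose A) = (mx_of A)^T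
  by apply/matrixP => i j; rewrite !mxE.
exists Z; split=> q; apply: col_of_inj; rewrite -!mulmx_col_of mulmxA.
  by rewrite ZE mulVmx // mul1mx.
by rewrite (trE Z) (trE K) ZE -trmx_mul mulmxV // trmx1 mul1mx.
Qed.

(* [1 - P] is singular; adding the rank-one matrix [p 1^T] makes it invertible. *)
Definition bordered (R : realType) (X : finType) (P : X -> X -> R) (p : X -> R) :
  X -> X -> R := fun x y => (x == y)%:R - P x y + p x.

Lemma apply_bordered (R : realType) (X : finType) (P : X -> X -> R) (p q : X -> R) x :
  apply_col (bordered P p) q x = q x - apply_col P q x + p x * \sum_y q y.
Proof.
rewrite /apply_col /bordered; under eq_bigr do rewrite mulrDl mulrBl.
rewrite big_split /= sumrB -mulr_sumr; congr (_ - _ + _).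
rewrite (bigD1 x) //= eqxx mul1r big1 ?addr0 // => y.
by rewrite eq_sym => /negPf ->; rewrite mul0r.
Qed.

Lemma apply_bordered_transpose (R : realType) (X : finType) (P : X -> X -> R)
    (p q : X -> R) x :
  apply_col (transpose (bordered P p)) q x =
    q x - apply_col (transpose P) q x + \sum_y p y * q y.
Proof.
rewrite /apply_col /transpose /bordered; under eq_bigr do rewrite mulrDl mulrBl.
rewrite big_split /= sumrB; congr (_ - _ + _).
rewrite (bigD1 x) //= eqxx mul1r big1 ?addr0 // => y.
by move=> /negPf ->; rewrite mul0r.
Qed.

(** If [K q = 0], summing over the states gives [q] total mass zero, because [P] preserves mass;
    then [P q = q], so [q] is a multiple of the stationary law and vanishes. The first clause serves
    perturbations of stationary laws, the transposed one those of left Perron vectors. *)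
Lemma bordered_inverse (R : realType) (X : finType) (P : X -> X -> R) (x0 : X) :
  transition_matrix P -> connected_support P ->
  exists Z : X -> X -> R, let K := bordered P (stationary P) in
    (forall q x, apply_col Z (apply_col K q) x = q x) /\
    (forall q x, apply_col (transpose Z) (apply_col (transpose K) q) x = q x).
Proof.
move=> tP cP; have [p0 p1 pP] := stationaryP x0 tP cP; have [P0 P1] := tP.
apply: trivial_kernel_inverse => q Kq.
have sq : \sum_y q y = 0.
  have : \sum_x apply_col (bordered P (stationary P)) q x = 0 by rewrite big1.
  under eq_bigr do rewrite apply_bordered.
  rewrite big_split /= sumrB -mulr_suml p1 mul1r.
  have -> : \sum_x apply_col P q x = \sum_y q y.
    rewrite exchange_big /=; apply: eq_bigr => y _.
    by rewrite -mulr_suml P1 mul1r.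
  by rewrite subrr add0r.
have [c qc] : exists c, forall x, q x = c * stationary P x.
  apply: (@eigenvector_proportional _ _ P 1) => //.
    by move=> x; rewrite mul1r pP.
  move=> x; have := Kq x; rewrite apply_bordered sq mulr0 addr0 mul1r => /eqP.
  by rewrite subr_eq0 => /eqP <-.
have c0 : c = 0.
  by move: sq; under eq_bigr do rewrite qc; rewrite -mulr_sumr p1 mulr1.
by move=> x; rewrite qc c0 mul0r.
Qed.

(** * Perturbation of the Perron vector *)

Lemma cvg_mul_bounded (R : realType) (T : Type) (F : set_system T) (a b : T -> R) (B : R) :
  Filter F -> a t @[t --> F] --> 0 -> (forall t, `|b t| <= B) ->
  a t * b t @[t --> F] --> 0.
Proof.
move=> FF a0 bB; apply/cvgr0Pnorm_le => e e0.
have B1 : 0 < `|B| + 1 by rewrite ltr_wpDl.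
near=> t; rewrite normrM -(divfK (lt0r_neq0 B1) e).
apply: ler_pM => //.
  near: t; apply: (cvgr0_norm_le a a0); exact: divr_gt0.
apply: (le_trans (bB t)); apply: (le_trans (ler_norm _)).
by rewrite lerDl.
Unshelve. all: by end_near. Qed.

Lemma is_derive0P (R : realType) (F : R -> R) (l : R) :
  is_derive (0 : R) 1 F l <-> h^-1 * (F h - F 0) @[h --> 0^'] --> l.
Proof.
have E : (fun h : R => h^-1 * (F h - F 0)) = (fun h : R => h^-1 *: ((F \o shift 0) (h *: 1) - F 0)).
  by apply/funext => h; rewrite /= addr0 /GRing.scale /= mulr1.
rewrite E; split.
  by move=> [ex <-]; exact: ex.
move=> cv; split; last by apply: cvg_lim cv.
by apply/cvg_ex; exists l.
Qed.

Lemma derive_along (R : realType) (V : normedModType R) (f : V -> R) (a v : V) (l : R) :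
  is_derive (0 : R) 1 (fun h : R => f (h *: v + a)) l -> 'D_v f a = l.
Proof.
move=> /is_derive0P cv; apply: cvg_lim => //.
suff -> : (fun h : R => h^-1 *: ((f \o shift a) (h *: v) - f a)) =
  (fun h => h^-1 * (f (h *: v + a) - f (0 *: v + a))) by [].
by apply/funext => h /=; rewrite scale0r add0r.
Qed.

Lemma is_derive_expR_scale (R : realType) (c : R) :
  is_derive (0 : R) 1 (fun h : R => expR (h * c)) c.
Proof.
have e := @is_derive1_comp R expR (fun h => h * c) 0 (expR (0 * c)) c (is_derive_expR _) _.
rewrite mul0r expR0 mul1r in e; apply: e.
apply/is_derive0P; apply: (@cvg_trans _ (cst c @ (0:R)^')); last exact: cvg_cst.
apply: near_eq_cvg; near=> h; rewrite mul0r subr0 mulKf //.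
by near: h; exact: nbhs_dnbhs_neq.
Unshelve. all: by end_near. Qed.

(* Left Perron vector [w h] of the tilted kernel [P x y * expR (h * G x y)],
   normalized by the stationary law of [P], which keeps it bounded; applying the
   bordered inverse to [w h - 1] then gives its difference quotient. *)
Lemma perron_perturbation (R : realType) (X : finType) (P G : X -> X -> R) (x0 : X)
    (rho : R -> R) (w : R -> X -> R) :
  transition_matrix P -> connected_support P ->
  (forall h x, 0 < w h x) -> (forall h, \sum_x stationary P x * w h x = 1) ->
  (forall h y, \sum_x w h x * (P x y * expR (h * G x y)) = rho h * w h y) ->
  [/\ rho 0 = 1,
    is_derive (0 : R) 1 rho (\sum_y stationary P y * \sum_x P x y * G x y),
    forall x, w 0 x = 1 &
    exists f : X -> R, forall x, is_derive (0 : R) 1 (fun h => w h x) (f x)].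
Proof.
move=> tP cP w0 pw wP; have [P0 P1] := tP.
have [p0 p1 pP] := stationaryP x0 tP cP.
have [Z /= [_ ZK]] := bordered_inverse x0 tP cP.
set p := stationary P in pw p0 p1 pP ZK *.
pose E h x y := expR (h * G x y) - 1.
(* By the eigenvalue equation, [D h] is [rho h * w h] minus the image of [w h] under the untilted
   kernel. *)
pose D h y := \sum_x P x y * (E h x y * w h x).
have DE h y : D h y = rho h * w h y - apply_col (transpose P) (w h) y.
  rewrite -wP -sumrB; apply: eq_bigr => x _; rewrite /E /transpose; ring.
have Pw h : \sum_y p y * apply_col (transpose P) (w h) y = 1.
  under eq_bigr do rewrite mulr_sumr.
  rewrite exchange_big /= -(pw h); apply: eq_bigr => x _.
  by rewrite -[in RHS]pP /apply_col mulr_suml; apply: eq_bigr => y _; rewrite /transpose; ring.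
(* Pairing with [p] isolates the eigenvalue: [w h] and its image under the untilted kernel both have
   [p]-mass 1. *)
have rhoE h : rho h - 1 = \sum_y p y * D h y.
  under eq_bigr do rewrite DE mulrBr mulrCA.
  by rewrite sumrB -mulr_sumr pw Pw mulr1.
(* As [w h - 1] has [p]-mass zero, the border does not act on it, and the inverse [Z] recovers it
   from quantities that are small with [h]. *)
have wE h x : w h x - 1 = \sum_y Z y x * (D h y - (rho h - 1) * w h y).
  rewrite -(ZK (fun x => w h x - 1)); apply: eq_bigr => y _.
  rewrite /transpose; congr (_ * _); rewrite apply_bordered_transpose DE.
  have -> : apply_col (transpose P) (fun x => w h x - 1) y = apply_col (transpose P) (w h) y - 1.
    rewrite -[X in _ - X](P1 y) -sumrB; apply: eq_bigr => z _.
    by rewrite /transpose; ring.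
  have -> : \sum_y0 p y0 * (w h y0 - 1) = 0.
    by under eq_bigr do rewrite mulrBr mulr1; rewrite sumrB pw p1 subrr.
  ring.
have wB x h : `|w h x| <= (p x)^-1.
  rewrite gtr0_norm // -[leRHS]mul1r ler_pdivlMr // -(pw h) mulrC (bigD1 x) //= lerDl.
  by rewrite sumr_ge0 // => y _; rewrite mulr_ge0 // ltW.
have dE x y : h^-1 * E h x y @[h --> (0 : R)^'] --> G x y.
  have /is_derive0P := is_derive_expR_scale (G x y).
  by rewrite mul0r expR0.
have h0 : (h : R) @[h --> (0 : R)^'] --> (0 : R) by exact: nbhs_dnbhs.
have E0 x y : E h x y @[h --> (0 : R)^'] --> 0.
  have : h * (h^-1 * E h x y) @[h --> (0 : R)^'] --> 0 * G x y by apply: cvgM.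
  rewrite mul0r; apply: cvg_trans; apply: near_eq_cvg; near=> h.
  by rewrite mulVKf //; near: h; exact: nbhs_dnbhs_neq.
have sum0 (c : X -> R) (f : X -> R -> R) :
    (forall x, f x h @[h --> (0 : R)^'] --> 0) ->
    \sum_x c x * f x h @[h --> (0 : R)^'] --> 0.
  move=> f0; rewrite [X in _ --> X](_ : _ = \sum_x c x * 0); last first.
    by rewrite big1 // => *; rewrite mulr0.
  apply: (@cvg_sumr _ _ _ _ (fun x h => c x * f x h) (fun x => c x * 0)) => x.
  by apply: cvgM; [exact: cvg_cst | exact: f0].
(* Convergence of [w h] is not yet known; the bound [wB], uniform in [h], suffices because [E h]
   tends to 0. *)
have D0 y : D h y @[h --> (0 : R)^'] --> 0.
  apply: (sum0 (P^~ y) (fun x h => E h x y * w h x)) => x.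
  exact: cvg_mul_bounded.
have rho1 : rho h - 1 @[h --> (0 : R)^'] --> 0.
  under eq_fun do rewrite rhoE.
  exact: (sum0 p (fun y h => D h y)).
have w1 x : w h x @[h --> (0 : R)^'] --> (1 : R).
  have -> : (fun h => w h x) = (fun h => (w h x - 1) + 1) by apply/funext => h; rewrite subrK.
  rewrite -[X in _ --> X]add0r; apply: cvgD; last exact: cvg_cst.
  under eq_fun do rewrite wE.
  apply: (sum0 (Z^~ x) (fun y h => D h y - (rho h - 1) * w h y)) => y.
  rewrite -[X in _ --> X]subr0; apply: cvgB; first exact: D0.
  exact: cvg_mul_bounded.
have dD y : h^-1 * D h y @[h --> (0 : R)^'] --> \sum_x P x y * G x y.
  have -> : (fun h => h^-1 * D h y) = (fun h => \sum_x P x y * ((h^-1 * E h x y) * w h x)).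
    by apply/funext => h; rewrite mulr_sumr; apply: eq_bigr => x _; ring.
  apply: (@cvg_sumr _ _ _ _ (fun x h => P x y * ((h^-1 * E h x y) * w h x))
    (fun x => P x y * G x y)) => x.
  apply: cvgM; first exact: cvg_cst.
  by rewrite -[X in _ --> X]mulr1; apply: cvgM.
have dr : h^-1 * (rho h - 1) @[h --> (0 : R)^'] --> \sum_y p y * \sum_x P x y * G x y.
  have -> : (fun h => h^-1 * (rho h - 1)) = (fun h => \sum_y p y * (h^-1 * D h y)).
    by apply/funext => h; rewrite rhoE mulr_sumr; apply: eq_bigr => x _; ring.
  apply: (@cvg_sumr _ _ _ _ (fun y h => p y * (h^-1 * D h y))
    (fun y => p y * \sum_x P x y * G x y)) => y.
  by apply: cvgM; [exact: cvg_cst | exact: dD].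
have D00 y : D 0 y = 0.
  by rewrite /D big1 // => x _; rewrite /E mul0r expR0 subrr mul0r mulr0.
have rho0 : rho 0 = 1.
  by apply/eqP; rewrite -subr_eq0 rhoE big1 // => y _; rewrite D00 mulr0.
have w00 x : w 0 x = 1.
  apply/eqP; rewrite -subr_eq0 wE big1 // => y _.
  by rewrite D00 rho0 subrr mul0r subr0 mulr0.
split=> //; first by apply/is_derive0P; rewrite rho0.
set eta := \sum_y _ in dr.
(* The witness is the termwise limit of [wE] divided by [h]. *)
exists (fun x => \sum_y Z y x * (\sum_z P z y * G z y - eta * 1)) => x.
apply/is_derive0P; rewrite w00.
have -> : (fun h => h^-1 * (w h x - 1)) =
    (fun h => \sum_y Z y x * (h^-1 * D h y - (h^-1 * (rho h - 1)) * w h y)).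
  by apply/funext => h; rewrite wE mulr_sumr; apply: eq_bigr => y _; ring.
apply: (@cvg_sumr _ _ _ _ (fun y h => Z y x * (h^-1 * D h y - (h^-1 * (rho h - 1)) * w h y))
  (fun y => Z y x * (\sum_z P z y * G z y - eta * 1))) => y.
apply: cvgM; first exact: cvg_cst.
by apply: cvgB; [exact: dD | apply: cvgM; [exact: dr | exact: w1]].
Unshelve. all: by end_near. Qed.

(** * Derivatives along the exponential family *)

Lemma tilted_ge0 (R : realType) (X : finType) (d : nat) (W : X -> X -> R)
    (g : 'I_d -> X -> X -> R) (theta : 'rV[R]_d) x x' :
  (forall x x', 0 <= W x x') -> 0 <= tilted W g theta x x'.
Proof. by move=> W0; rewrite mulr_ge0 ?expR_ge0. Qed.

Lemma tilted_connected (R : realType) (X : finType) (d : nat) (W : X -> X -> R)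
    (g : 'I_d -> X -> X -> R) (theta : 'rV[R]_d) :
  connected_support W -> connected_support (tilted W g theta).
Proof. by apply: connected_support_sub => x x' Wp; rewrite mulr_gt0 ?expR_gt0. Qed.

Lemma tilted_along (R : realType) (X : finType) (d : nat) (W : X -> X -> R)
    (g : 'I_d -> X -> X -> R) (theta : 'rV[R]_d) (j : 'I_d) (h : R) x x' :
  tilted W g (h *: delta_mx 0 j + theta) x x' =
  tilted W g theta x x' * expR (h * g j x x').
Proof.
rewrite /tilted -mulrA -expRD; congr (_ * expR _).
rewrite addrC; under eq_bigr do rewrite !mxE eqxx /= mulrDl.
rewrite big_split /=; congr (_ + _).
by rewrite (bigD1 j) //= eqxx mulr1 big1 ?addr0 // => k /negPf ->; rewrite mulr0 mul0r.
Qed.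

Lemma PF_eigenvalue_tilted_gt0 (R : realType) (X : finType) (d : nat) (W : X -> X -> R)
    (g : 'I_d -> X -> X -> R) (theta : 'rV[R]_d) (x0 : X) :
  transition_matrix W -> connected_support W ->
  0 < PF_eigenvalue (tilted W g theta).
Proof.
move=> [W0 W1] cW; apply: (PF_eigenvalue_gt0 (x0 := x0)).
- by move=> x x'; apply: tilted_ge0.
- exact: tilted_connected.
have [x /= Wx] : exists x, true && (0 < W x x0).
  by apply: psumr_neq0P => //; rewrite W1; apply/eqP/oner_neq0.
by exists x; rewrite mulr_gt0 ?expR_gt0.
Qed.

(** The column sums apply the transposed tilted matrix to its own Perron vector, and the two
    normalizing factors cancel the result to 1. *)
Lemma exp_family_transition (R : realType) (X : finType) (d : nat) (W : X -> X -> R)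
    (g : 'I_d -> X -> X -> R) (theta : 'rV[R]_d) (x0 : X) :
  transition_matrix W -> connected_support W ->
  transition_matrix (exp_family W g theta) /\ connected_support (exp_family W g theta).
Proof.
move=> tW cW; have [W0 W1] := tW.
have l0 := PF_eigenvalue_tilted_gt0 g theta x0 tW cW.
have [||v [_ _ u0 uA]] := @perron_pair _ _ (tilted W g theta) x0.
- by move=> x x'; apply: tilted_ge0.
- exact: tilted_connected.
rewrite /exp_family; move: (PF_eigenvector _) u0 uA => u u0 uA.
split; first split.
- move=> x x'; rewrite !mulr_ge0 ?invr_ge0 ?expR_ge0 ?W0 // ltW //.
- move=> x'; rewrite -mulr_suml.
  have -> : \sum_x (PF_eigenvalue (tilted W g theta))^-1 * u x * tilted W g theta x x' =
     (PF_eigenvalue (tilted W g theta))^-1 * apply_col (transpose (tilted W g theta)) u x'.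
    by rewrite mulr_sumr; apply: eq_bigr => x _; rewrite /transpose; ring.
  by rewrite uA mulKf ?gt_eqF // divff ?gt_eqF.
apply: connected_support_sub (tilted_connected (g := g) (theta := theta) cW) => x x' h.
by apply: mulr_gt0; [apply: mulr_gt0; [apply: mulr_gt0; [rewrite invr_gt0|]|]|rewrite invr_gt0].
Qed.

(* [f] is the derivative along [theta j] of the logarithm of the Perron vector
   [P3]; it makes the score [g j - eta + f x - f y] a martingale difference. *)
Lemma exp_family_derive (R : realType) (X : finType) (d : nat) (W : X -> X -> R)
    (g : 'I_d -> X -> X -> R) (theta : 'rV[R]_d) (j : 'I_d) (x0 : X) :
  transition_matrix W -> connected_support W ->
  let P := exp_family W g theta in
  let eta := \sum_y stationary P y * \sum_x P x y * g j x y in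
  is_derive (0 : R) 1 (fun h : R => potential W g (h *: delta_mx 0 j + theta)) eta /\
  exists f : X -> R, let m x y := g j x y - eta + (f x - f y) in
    (forall x y, is_derive (0 : R) 1
      (fun h : R => exp_family W g (h *: delta_mx 0 j + theta) x y) (P x y * m x y)) /\
    forall y, \sum_x P x y * m x y = 0.
Proof.
move=> tW cW P eta; have [W0 W1] := tW.
pose th (h : R) := h *: delta_mx 0 j + theta.
have th0 : th 0 = theta by rewrite /th scale0r add0r.
have [tP cP] := exp_family_transition g theta x0 tW cW.
have [p0 p1 pP] := stationaryP x0 tP cP.
have [P0 P1] := tP.
pose l t := PF_eigenvalue (tilted W g t).
have l0 t : 0 < l t by apply: PF_eigenvalue_tilted_gt0.
pose u t := PF_eigenvector (transpose (tilted W g t)).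
have [u0 uA] : (forall t x, 0 < u t x) /\
    forall t x, apply_col (transpose (tilted W g t)) (u t) x = l t * u t x.
  by split=> t x; have [||v [_ _ a b]] := @perron_pair _ _ (tilted W g t) x0;
    do ?[by move=> y y'; apply: tilted_ge0 | exact: tilted_connected];
    [exact: a | exact: b].
have un0 t x : u t x != 0 by rewrite gt_eqF.
have ln0 t : l t != 0 by rewrite gt_eqF.
have PE x y : P x y = (l theta)^-1 * u theta x * tilted W g theta x y / u theta y by [].
(* Up to a scalar, the tilted matrix at [th h], conjugated by [u theta], is [P] tilted by [h * g j].
   Its left Perron vector is the ratio of the two Perron vectors, which [N h] brings to [p]-mass
   1. *)
pose N h := \sum_x stationary P x * (u (th h) x / u theta x).
have N0 h : 0 < N h.
  rewrite /N (bigD1 x0) //= ltr_pwDl ?mulr_gt0 ?invr_gt0 //.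
  by rewrite sumr_ge0 // => x _; rewrite ltW // !mulr_gt0 ?invr_gt0.
have Nn0 h : N h != 0 by rewrite gt_eqF.
pose w h x := u (th h) x / u theta x / N h.
pose rho h := l (th h) / l theta.
have w0 h x : 0 < w h x by rewrite !divr_gt0.
have pw h : \sum_x stationary P x * w h x = 1.
  rewrite -(divff (Nn0 h)) /w [in RHS]/N [RHS]mulr_suml.
  by apply: eq_bigr => x _; rewrite mulrA.
have wP h y : \sum_x w h x * (P x y * expR (h * g j x y)) = rho h * w h y.
  transitivity ((l theta)^-1 / N h / u theta y *
      apply_col (transpose (tilted W g (th h))) (u (th h)) y).
    rewrite /apply_col mulr_sumr; apply: eq_bigr => x _.
    rewrite /transpose (tilted_along W g theta j h x y) (PE x y) /w.
    move: (un0 theta x) (un0 theta y) (ln0 theta) (Nn0 h).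
    move: (u _ x) (u _ y) (l _) (N h) (tilted _ _ _ x y) (expR _) (u _ x) => a b c n t e s *.
    by field; do !(apply/andP; split).
  rewrite uA /rho /w.
  move: (un0 theta y) (ln0 theta) (Nn0 h).
  move: (u theta y) (l theta) (N h) (l (th h)) (u (th h) y) => a c n t s *.
  by field; do !(apply/andP; split).
have [rho0 drho w00 [f df]] := perron_perturbation x0 tP cP w0 pw wP.
rewrite -/eta in drho.
have dphi : is_derive (0 : R) 1 (fun h : R => potential W g (th h)) eta.
  have -> : (fun h : R => potential W g (th h)) = (fun h => (@ln R \o rho) h + ln (l theta)).
    apply/funext => h; rewrite /= -lnM ?posrE ?divr_gt0 //.
    by rewrite /rho divfK.
  apply: (@is_derive_eq _ _ _ _ _ _ _ (1 * eta + 0)); last by rewrite mul1r addr0.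
  apply: is_deriveD; first apply: is_derive1_comp => //.
  by rewrite rho0; have := is_derive1_ln (@ltr01 R); rewrite invr1.
split=> //; exists f => m.
have dP x y : is_derive (0 : R) 1 (fun h : R => exp_family W g (th h) x y) (P x y * m x y).
  (* The factor [N h] cancels between the two states, so the scale in which [xget] chooses the
     Perron vectors cannot spoil differentiability. *)
  have -> : (fun h : R => exp_family W g (th h) x y) =
     (fun h => ((rho h)^-1 * w h x) * ((P x y * expR (h * g j x y)) * (w h y)^-1)).
    apply/funext => h; rewrite (PE x y) /rho /w /exp_family (tilted_along W g theta j h x y).
    rewrite -/(l _) -/(u _).
    move: (un0 theta x) (un0 theta y) (ln0 theta) (Nn0 h).
    move: (un0 (th h) x) (un0 (th h) y) (ln0 (th h)).
    move: (u theta x) (u theta y) (l theta) (N h) (u (th h) x) (u (th h) y) (l (th h)).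
    move: (tilted _ _ _ x y) (expR _) => t e a b c n a' b' c' *.
    by field; do !(apply/andP; split).
  have d1 : is_derive (0 : R) 1 (fun h => (rho h)^-1) (- eta).
    apply: (@is_derive_eq _ _ _ _ _ _ _ (- rho 0 ^- 2 *: eta)); last first.
      by rewrite rho0 expr1n invr1 scaleN1r.
    by apply: is_deriveV => //; rewrite rho0 oner_neq0.
  have d2 : is_derive (0 : R) 1 (fun h => (w h y)^-1) (- f y).
    apply: (@is_derive_eq _ _ _ _ _ _ _ (- w 0 y ^- 2 *: f y)); last first.
      by rewrite w00 expr1n invr1 scaleN1r.
    by apply: (@is_deriveV _ (fun h => w h y)) => //; rewrite w00 oner_neq0.
  have d3 := is_deriveM d1 (df x).
  have d4 := is_deriveM (is_deriveM (is_derive_cst (P x y) (0 : R) 1)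
    (is_derive_expR_scale (g j x y))) d2.
  apply: (is_derive_eq (is_deriveM d3 d4)).
  rewrite /m !fctE rho0 !w00 mul0r expR0 invr1.
  rewrite /GRing.scale /=.
  move: (P x y) (g j x y) (eta) (f x) (f y) => *; ring.
split=> // y.
(* The column sums are 1 for every [h], so their difference quotient is identically 0, while its
   termwise limit is the sum of the scores. *)
have c1 : h^-1 * (1 - 1) @[h --> (0 : R)^'] --> (0 : R).
  by under eq_fun do rewrite subrr mulr0; exact: cvg_cst.
have c2 : h^-1 * (1 - 1) @[h --> (0 : R)^'] --> \sum_x P x y * m x y.
  have -> : (fun h : R => h^-1 * (1 - 1)) =
      (fun h => \sum_x h^-1 * (exp_family W g (th h) x y - exp_family W g (th 0) x y)).
    apply/funext => h; rewrite -mulr_sumr sumrB.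
    have S1 t : \sum_x exp_family W g t x y = 1.
      by have [[_ ->]] := exp_family_transition g t x0 tW cW.
    by congr (_ * (_ - _)); rewrite S1.
  apply: (@cvg_sumr _ _ _ _ (fun x h =>
      h^-1 * (exp_family W g (th h) x y - exp_family W g (th 0) x y))
    (fun x => P x y * m x y)) => x.
  by apply/is_derive0P.
exact: (cvg_unique _ c2 c1).
Qed.

(** With [q] stationary for [Q] and [p] for [P], the difference [q - p] has mass zero and
    [(1 - P) (q - p) = (Q - P) q]. The bordered inverse bounds it by the change of kernel, as the
    entries of [q] are at most 1. *)
Lemma stationary_cvg (R : realType) (X : finType) (T : Type) (F : set_system T)
    (P : X -> X -> R) (Q : T -> X -> X -> R) (x0 : X) : Filter F ->
  transition_matrix P -> connected_support P ->
  (forall t, transition_matrix (Q t)) -> (forall t, connected_support (Q t)) ->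
  (forall x y, Q t x y @[t --> F] --> P x y) ->
  forall x, stationary (Q t) x @[t --> F] --> stationary P x.
Proof.
move=> FF tP cP tQ cQ QP x.
have [p0 p1 pP] := stationaryP x0 tP cP.
have [Z /= [ZK _]] := bordered_inverse x0 tP cP.
set p := stationary P in p0 p1 pP ZK *.
pose q t := stationary (Q t).
have q0 t y : 0 < q t y by have [h _ _] := stationaryP x0 (tQ t) (cQ t); exact: h.
have q1 t : \sum_y q t y = 1 by have [_ h _] := stationaryP x0 (tQ t) (cQ t); exact: h.
have qQ t y : apply_col (Q t) (q t) y = q t y
  by have [_ _ h] := stationaryP x0 (tQ t) (cQ t); exact: h.
have qE t : q t x = \sum_y Z x y * (\sum_z (Q t y z - P y z) * q t z) + p x.
  apply/eqP; rewrite -subr_eq; apply/eqP.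
  rewrite -(ZK (fun x => q t x - p x)); apply: eq_bigr => y _; congr (_ * _).
  rewrite apply_bordered sumrB q1 p1 subrr mulr0 addr0 -[in LHS]qQ -[in LHS]pP.
  rewrite /apply_col -!sumrB; apply: eq_bigr => z _; ring.
have -> : (fun t => stationary (Q t) x) =
    (fun t => \sum_y Z x y * (\sum_z (Q t y z - P y z) * q t z) + p x).
  by apply/funext => t; exact: qE.
rewrite -[X in _ --> X]add0r; apply: cvgD; last exact: cvg_cst.
have zero (c : X -> R) (a : X -> T -> R) : (forall y, a y t @[t --> F] --> 0) ->
    \sum_y c y * a y t @[t --> F] --> 0.
  move=> a0; rewrite [X in _ --> X](_ : _ = \sum_y c y * 0); last first.
    by rewrite big1 // => *; rewrite mulr0.
  apply: (@cvg_sumr _ _ _ _ (fun y t => c y * a y t) (fun y => c y * 0)) => y.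
  by apply: cvgM; [exact: cvg_cst | exact: a0].
apply: (zero (Z x) (fun y t => \sum_z (Q t y z - P y z) * q t z)) => y.
have -> : (fun t => \sum_z (Q t y z - P y z) * q t z) =
    (fun t => \sum_z 1 * ((Q t y z - P y z) * q t z)).
  by apply/funext => t; apply: eq_bigr => z _; rewrite mul1r.
apply: (zero (fun=> 1) (fun z t => (Q t y z - P y z) * q t z)) => z.
apply: (@cvg_mul_bounded _ _ _ _ _ 1).
  rewrite -(subrr (P y z)); apply: cvgB; last exact: cvg_cst.
  exact: QP.
move=> t; rewrite gtr0_norm // -(q1 t) (bigD1 z) //= lerDl.
by rewrite sumr_ge0 // => *; exact: ltW.
Qed.

Lemma potential_gradient (R : realType) (X : finType) (d : nat) (W : X -> X -> R)
    (g : 'I_d -> X -> X -> R) (theta : 'rV[R]_d) (j : 'I_d) (x0 : X) :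
  transition_matrix W -> connected_support W ->
  let P := exp_family W g theta in
  pderive j (potential W g) theta =
    \sum_y stationary P y * \sum_x P x y * g j x y.
Proof.
move=> tW cW P; apply: derive_along.
by have [] := exp_family_derive g theta j x0 tW cW.
Qed.

(** The coboundary [f x - f y] has mean zero under any stationary step law, so [f] and [e] may come
    from a parameter other than that of [P]. *)
Lemma stationary_mean_score (R : realType) (X : finType) (P g : X -> X -> R)
    (p f : X -> R) (e : R) :
  transition_matrix P -> \sum_y p y = 1 -> (forall x, apply_col P p x = p x) ->
  \sum_y p y * \sum_x P x y * (g x y - e + (f x - f y)) =
  \sum_y p y * \sum_x P x y * g x y - e.
Proof.
move=> [_ P1] p1 pP.
pose a := \sum_y \sum_x f x * (P x y * p y).
have aE : a = \sum_y f y * p y.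
  by rewrite /a exchange_big /=; apply: eq_bigr => x _; rewrite -mulr_sumr -[in RHS]pP.
have inner y : p y * \sum_x P x y * (g x y - e + (f x - f y)) =
    p y * (\sum_x P x y * g x y) - e * p y + (\sum_x f x * (P x y * p y) - f y * p y).
  transitivity (p y * (\sum_x P x y * g x y) - (\sum_x P x y) * (e * p y)
      + (\sum_x f x * (P x y * p y) - (\sum_x P x y) * (f y * p y))).
    rewrite !mulr_suml !mulr_sumr -!sumrB -big_split /=.
    by apply: eq_bigr => x _; ring.
  by rewrite P1 !mul1r.
under eq_bigr do rewrite inner.
by rewrite big_split /= !sumrB -mulr_sumr p1 mulr1 -/a aE subrr addr0.
Qed.

(** The gradient at the shifted parameter is expressed with the scores frozen at [theta]. Their
    conditional mean under [P] is zero, so only [Q h - P] enters, and the limit needs mere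
    continuity of the stationary law. *)
Lemma potential_hessian (R : realType) (X : finType) (d : nat) (W : X -> X -> R)
    (g : 'I_d -> X -> X -> R) (theta : 'rV[R]_d) (x0 : X) :
  transition_matrix W -> connected_support W ->
  let P := exp_family W g theta in
  exists f : 'I_d -> X -> R,
    let m j x y := g j x y - pderive j (potential W g) theta + (f j x - f j y) in
    (forall j y, \sum_x P x y * m j x y = 0) /\
    forall j k, hessian (potential W g) theta j k =
      \sum_y stationary P y * \sum_x P x y * (m j x y * m k x y).
Proof.
move=> tW cW P.
have grad t k := potential_gradient g t k x0 tW cW.
have /choice[f fP] : forall j, exists f : X -> R,
    let m x y := g j x y - pderive j (potential W g) theta + (f x - f y) in
    (forall x y, is_derive (0 : R) 1
      (fun h : R => exp_family W g (h *: delta_mx 0 j + theta) x y) (P x y * m x y)) /\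
    forall y, \sum_x P x y * m x y = 0.
  by move=> j; rewrite grad; have [] := exp_family_derive g theta j x0 tW cW.
exists f => m; split=> [j|j k]; first by have [] := fP j.
rewrite mxE; apply: derive_along; apply/is_derive0P.
pose Q (h : R) := exp_family W g (h *: delta_mx 0 j + theta).
have Q0 : Q 0 = P by rewrite /Q scale0r add0r.
have [tQ cQ] : (forall h, transition_matrix (Q h)) /\ (forall h, connected_support (Q h)).
  by split=> h; have [] := exp_family_transition g (h *: delta_mx 0 j + theta) x0 tW cW.
have QE h : pderive k (potential W g) (h *: delta_mx 0 j + theta) =
    \sum_y stationary (Q h) y * (\sum_x (Q h x y - P x y) * m k x y) +
    pderive k (potential W g) theta.
  rewrite grad -/(Q h).
  have [q0 q1 qQ] := stationaryP x0 (tQ h) (cQ h).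
  have -> : \sum_y stationary (Q h) y * (\sum_x (Q h x y - P x y) * m k x y) =
     \sum_y stationary (Q h) y * (\sum_x Q h x y * m k x y).
    apply: eq_bigr => y _; congr (_ * _).
    have [_ /(_ y) mk] := fP k.
    under eq_bigr do rewrite mulrBl.
    by rewrite sumrB [X in _ - X]mk subr0.
  set e := pderive _ _ theta.
  by rewrite [X in _ = X + _](stationary_mean_score _ _ _ (tQ h) q1 qQ) subrK.
have -> : (fun h : R => h^-1 * (pderive k (potential W g) (h *: delta_mx 0 j + theta) -
      pderive k (potential W g) (0 *: delta_mx 0 j + theta))) =
    (fun h => \sum_y stationary (Q h) y * (\sum_x (h^-1 * (Q h x y - Q 0 x y)) * m k x y)).
  apply/funext => h; rewrite scale0r add0r QE addrK mulr_sumr Q0.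
  by apply: eq_bigr => y _; rewrite mulrCA mulr_sumr; congr (_ * _);
    apply: eq_bigr => x _; rewrite mulrA.
have dQ x y : h^-1 * (Q h x y - Q 0 x y) @[h --> (0 : R)^'] --> P x y * m j x y.
  have [dP _] := fP j; exact: (proj1 (is_derive0P _ _) (dP x y)).
have cQP x y : Q h x y @[h --> (0 : R)^'] --> P x y.
  have h0 : (h : R) @[h --> (0 : R)^'] --> (0 : R) by exact: nbhs_dnbhs.
  have : h * (h^-1 * (Q h x y - Q 0 x y)) + P x y @[h --> (0 : R)^']
      --> 0 * (P x y * m j x y) + P x y.
    by apply: cvgD; [exact: cvgM | exact: cvg_cst].
  rewrite mul0r add0r; apply: cvg_trans; apply: near_eq_cvg; near=> h.
  rewrite mulVKf; first by rewrite Q0 subrK.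
  by near: h; exact: nbhs_dnbhs_neq.
have [tP cP] := exp_family_transition g theta x0 tW cW.
apply: (@cvg_sumr _ _ _ _ (fun y h =>
    stationary (Q h) y * (\sum_x (h^-1 * (Q h x y - Q 0 x y)) * m k x y))
  (fun y => stationary P y * \sum_x P x y * (m j x y * m k x y))) => y.
apply: cvgM; first exact: (@stationary_cvg _ _ _ _ P Q x0 _ tP cP tQ cQ cQP y).
apply: (@cvg_sumr _ _ _ _ (fun x h => (h^-1 * (Q h x y - Q 0 x y)) * m k x y)
  (fun x => P x y * (m j x y * m k x y))) => x.
by rewrite mulrA; apply: cvgM; [exact: dQ | exact: cvg_cst].
Unshelve. all: by end_near. Qed.

(** * Additive functionals of stationary chains *)

Definition extend (X : finType) (n : nat) (w : {ffun 'I_n.+1 -> X}) (x : X) :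
    {ffun 'I_n.+2 -> X} :=
  [ffun i => if unlift ord_max i is Some k then w k else x].

Definition edge_sum (R : realType) (X : finType) (G : X -> X -> R) (n : nat)
    (w : {ffun 'I_n.+1 -> X}) : R := \sum_(i < n) G (target w i) (source w i).

Lemma extend_last (X : finType) (n : nat) (w : {ffun 'I_n.+1 -> X}) x :
  extend w x ord_max = x.
Proof. by rewrite ffunE unlift_none. Qed.

Lemma extend_lift (X : finType) (n : nat) (w : {ffun 'I_n.+1 -> X}) x k :
  extend w x (lift ord_max k) = w k.
Proof. by rewrite ffunE liftK. Qed.

Lemma source_extend (X : finType) (n : nat) (w : {ffun 'I_n.+1 -> X}) x i :
  source (extend w x) i = w i.
Proof.
rewrite /source -(extend_lift w x); congr (extend w x _).
by apply: ord_inj; rewrite lift_max.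
Qed.

Lemma target_extend (X : finType) (n : nat) (w : {ffun 'I_n.+1 -> X}) x (i : 'I_n) :
  target (extend w x) (widen_ord (leqnSn n) i) = target w i.
Proof.
rewrite /target -(extend_lift w x); congr (extend w x _).
by apply: ord_inj; rewrite lift_max.
Qed.

Lemma target_extend_last (X : finType) (n : nat) (w : {ffun 'I_n.+1 -> X}) x :
  target (extend w x) ord_max = x.
Proof.
rewrite /target -[RHS](extend_last w x); congr (extend w x _).
exact: val_inj.
Qed.

Lemma edge_sum_extend (R : realType) (X : finType) (G : X -> X -> R) (n : nat)
    (w : {ffun 'I_n.+1 -> X}) x :
  edge_sum G (extend w x) = edge_sum G w + G x (w ord_max).
Proof.
rewrite /edge_sum big_ord_recr /= target_extend_last source_extend; congr (_ + _).
by apply: eq_bigr => i _; rewrite target_extend source_extend.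
Qed.

Lemma markov_law_extend (R : realType) (X : finType) (P : X -> X -> R) (p : X -> R)
    (n : nat) (w : {ffun 'I_n.+1 -> X}) x :
  markov_law P p (extend w x) = markov_law P p w * P x (w ord_max).
Proof.
rewrite /markov_law big_ord_recr /= target_extend_last source_extend.
have -> : extend w x ord0 = w ord0.
  by rewrite -(extend_lift w x); congr (extend w x _); apply: val_inj.
under eq_bigr do rewrite target_extend source_extend.
by rewrite mulrAC.
Qed.

Lemma sum_paths_extend (R : realType) (X : finType) (n : nat)
    (F : {ffun 'I_n.+2 -> X} -> R) :
  \sum_w F w = \sum_w \sum_x F (extend w x).
Proof.
rewrite pair_big /= (reindex (fun q : {ffun 'I_n.+1 -> X} * X => extend q.1 q.2)) //=.
apply: onW_bij.
exists (fun w : {ffun 'I_n.+2 -> X} =>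
  ([ffun k : 'I_n.+1 => w (lift ord_max k)], w ord_max)).
  move=> [w x] /=; congr pair; last exact: extend_last.
  by apply/ffunP => k; rewrite ffunE extend_lift.
move=> w; apply/ffunP => i; rewrite ffunE /=.
by case: unliftP => [k ->|->]; rewrite ?ffunE.
Qed.

Lemma sum_length1_paths (R : realType) (X : finType) (F : {ffun 'I_1 -> X} -> R) :
  \sum_w F w = \sum_x F [ffun=> x].
Proof.
rewrite (reindex (fun x : X => [ffun=> x] : {ffun 'I_1 -> X})) //.
apply: onW_bij; exists (fun w : {ffun 'I_1 -> X} => w ord0) => [x|w]; first by rewrite ffunE.
by apply/ffunP => -[[|//] i0]; rewrite ffunE; congr (w _); apply: val_inj.
Qed.

(** Conditioning on all states but the last is the recursion behind the inductions below. *)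
Lemma markov_expectation_extend (R : realType) (X : finType) (P : X -> X -> R)
    (p : X -> R) (n : nat) (F : {ffun 'I_n.+2 -> X} -> R) :
  \sum_w markov_law P p w * F w =
  \sum_(w : {ffun 'I_n.+1 -> X}) markov_law P p w *
    \sum_x P x (w ord_max) * F (extend w x).
Proof.
rewrite sum_paths_extend; apply: eq_bigr => w _; rewrite mulr_sumr.
by apply: eq_bigr => x _; rewrite markov_law_extend mulrA.
Qed.

Lemma markov_law_ge0 (R : realType) (X : finType) (P : X -> X -> R)
    (p : X -> R) (n : nat) (w : {ffun 'I_n.+1 -> X}) :
  (forall x y, 0 <= P x y) -> (forall x, 0 <= p x) -> 0 <= markov_law P p w.
Proof. by move=> P0 p0; rewrite mulr_ge0 // prodr_ge0. Qed.

Lemma expectation_last (R : realType) (X : finType) (P : X -> X -> R)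
    (p : X -> R) (n : nat) (h : X -> R) :
  (forall x, apply_col P p x = p x) ->
  \sum_(w : {ffun 'I_n.+1 -> X}) markov_law P p w * h (w ord_max) =
  \sum_y p y * h y.
Proof.
move=> pP; elim: n h => [|n IH] h.
  rewrite sum_length1_paths; apply: eq_bigr => x _.
  by rewrite /markov_law big_ord0 mul1r !ffunE.
rewrite markov_expectation_extend.
under eq_bigr do under eq_bigr do rewrite extend_last.
rewrite (IH (fun y => \sum_x P x y * h x)).
under eq_bigr do rewrite mulr_sumr.
rewrite exchange_big /=; apply: eq_bigr => x _.
by rewrite -[in RHS]pP mulr_suml; apply: eq_bigr => y _; ring.
Qed.

Lemma markov_law_mass (R : realType) (X : finType) (P : X -> X -> R)
    (p : X -> R) (n : nat) :
  (forall x, apply_col P p x = p x) -> \sum_x p x = 1 ->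
  \sum_(w : {ffun 'I_n.+1 -> X}) markov_law P p w = 1.
Proof.
move=> pP p1; have := expectation_last n (fun=> 1) pP.
under eq_bigr do rewrite mulr1.
by under [in RHS]eq_bigr do rewrite mulr1; rewrite p1.
Qed.

Lemma expectation_edge_sum (R : realType) (X : finType) (P G : X -> X -> R)
    (p : X -> R) (n : nat) :
  transition_matrix P -> (forall x, apply_col P p x = p x) ->
  \sum_(w : {ffun 'I_n.+1 -> X}) markov_law P p w * edge_sum G w =
  n%:R * \sum_y p y * \sum_x P x y * G x y.
Proof.
move=> [_ P1] pP; elim: n => [|n IH].
  by rewrite mul0r big1 // => w _; rewrite /edge_sum big_ord0 mulr0.
rewrite markov_expectation_extend -natr1 mulrDl mul1r -IH.
rewrite -(expectation_last n (fun y => \sum_x P x y * G x y) pP) -big_split /=.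
apply: eq_bigr => w _; rewrite -mulrDr; congr (_ * _).
rewrite -[edge_sum G w]mul1r -[in RHS](P1 (w ord_max)) mulr_suml -big_split /=.
by apply: eq_bigr => x _; rewrite edge_sum_extend mulrDr.
Qed.

(** Given the past, the products of an old sum with a new increment average to zero; each new
    product of increments has the stationary mean, so the identity is exact for every [n]. *)
Lemma expectation_martingale (R : realType) (X : finType) (P M N : X -> X -> R)
    (p : X -> R) (n : nat) :
  transition_matrix P -> (forall x, apply_col P p x = p x) ->
  (forall y, \sum_x P x y * M x y = 0) -> (forall y, \sum_x P x y * N x y = 0) ->
  \sum_(w : {ffun 'I_n.+1 -> X}) markov_law P p w * (edge_sum M w * edge_sum N w) =
  n%:R * \sum_y p y * \sum_x P x y * (M x y * N x y).
Proof.
move=> [_ P1] pP PM PN; elim: n => [|n IH].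
  by rewrite mul0r big1 // => w _; rewrite /edge_sum big_ord0 mul0r mulr0.
rewrite markov_expectation_extend -natr1 mulrDl mul1r -IH.
rewrite -(expectation_last n (fun y => \sum_x P x y * (M x y * N x y)) pP) -big_split /=.
apply: eq_bigr => w _; rewrite -mulrDr; congr (_ * _).
under eq_bigr do rewrite !edge_sum_extend.
move: (edge_sum M w) (edge_sum N w) (w ord_max) => a b y.
transitivity ((\sum_x P x y) * (a * b) + a * (\sum_x P x y * N x y) + b * (\sum_x P x y * M x y) +
   \sum_x P x y * (M x y * N x y)).
  rewrite mulr_suml !mulr_sumr -!big_split /=; apply: eq_bigr => x _.
  ring.
by rewrite P1 PN PM !mulr0 !addr0 mul1r.
Qed.

(** The coboundary part of the score telescopes along the path, leaving only the two end states. *)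
Lemma edge_sum_score (R : realType) (X : finType) (G : X -> X -> R) (e : R)
    (f : X -> R) (n : nat) (w : {ffun 'I_n.+1 -> X}) :
  edge_sum G w - n%:R * e =
  edge_sum (fun x y => G x y - e + (f x - f y)) w + (f (w ord0) - f (w ord_max)).
Proof.
elim: n w => [|n IH] w.
  by rewrite /edge_sum !big_ord0 mul0r (ord1 ord_max) !subrr addr0.
have -> : w = extend [ffun k : 'I_n.+1 => w (lift ord_max k)] (w ord_max).
  apply/ffunP => i; rewrite ffunE.
  by case: unliftP => [k ->|->]; rewrite ?ffunE.
move: [ffun k => _] (w ord_max) => {}w x.
have -> : extend w x ord0 = w ord0.
  by rewrite -(extend_lift w x); congr (extend w x _); apply: val_inj.
rewrite !edge_sum_extend extend_last -natr1 mulrDl mul1r.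
have := IH w; set S := edge_sum _ w; set T := edge_sum _ w => h.
have -> : S = T + (f (w ord0) - f (w ord_max)) + n%:R * e by rewrite -h subrK.
ring.
Qed.

(** Weighted AM-GM on the cross terms: [a] trades a small multiple of the squares, whose mean grows
    like [n], against a constant independent of [n]. *)
Lemma product_perturbation (R : realType) (u v c d C a : R) : 0 < a ->
  `|c| <= C -> `|d| <= C ->
  `|(u + c) * (v + d) - u * v| <= a * (u * u + v * v) + (C * C / a + C * C).
Proof.
move=> a0 cC dC.
have amgm s t : `|t| <= C -> `|s * t| <= a * (s * s) + C * C / a / 2.
  move=> tC; rewrite normrM.
  have C0 : 0 <= C := le_trans (normr_ge0 _) tC.
  apply: (@le_trans _ _ (`|s| * C)); first by rewrite ler_wpM2l.
  have -> : s * s = `|s| * `|s| by rewrite -normrM ger0_norm // -expr2 sqr_ge0.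
  move: (`|s|) (normr_ge0 s) => r r0.
  have ai : a * a^-1 = 1 by rewrite divff // gt_eqF.
  have b0 : 0 < a^-1 by rewrite invr_gt0.
  (* Expanding this square gives [r * C <= a * (r * r) + C * C / (4 * a)], which is stronger than
     required. *)
  have : 0 <= a^-1 * ((a * r - C / 2) * (a * r - C / 2)).
    by rewrite mulr_ge0 ?(ltW b0) // -expr2 sqr_ge0.
  have -> : a^-1 * ((a * r - C / 2) * (a * r - C / 2)) =
     (a * a^-1) * (a * (r * r)) - (a * a^-1) * (r * C) + C * C * a^-1 / 4.
    by field; rewrite gt_eqF.
  rewrite ai !mul1r.
  have : 0 <= C * C / a by rewrite mulr_ge0 ?mulr_ge0 // ltW.
  lra.
have -> : (u + c) * (v + d) - u * v = u * d + v * c + c * d by ring.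
apply: (le_trans (ler_normD _ _)); rewrite addrA.
apply: lerD; last by rewrite normrM ler_pM.
apply: (le_trans (ler_normD _ _)).
have := amgm u d dC; have := amgm v c cC.
rewrite mulrDr; lra.
Qed.

(** The pathwise estimate [product_perturbation] is averaged over the path law; the martingale
    squares then contribute exactly [n] times their stationary means. *)
Lemma edge_sum_covariance_bound (R : realType) (X : finType) (P G H : X -> X -> R)
    (p f h : X -> R) (s t C a : R) (n : nat) :
  let M x y := G x y - s + (f x - f y) in
  let N x y := H x y - t + (h x - h y) in
  transition_matrix P -> (forall x, 0 <= p x) -> \sum_x p x = 1 ->
  (forall x, apply_col P p x = p x) ->
  (forall y, \sum_x P x y * M x y = 0) -> (forall y, \sum_x P x y * N x y = 0) ->
  (forall x y, `|f x - f y| <= C) -> (forall x y, `|h x - h y| <= C) -> 0 < a ->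
  `|\sum_(w : {ffun 'I_n.+1 -> X}) markov_law P p w *
      ((edge_sum G w - n%:R * s) * (edge_sum H w - n%:R * t)) -
    n%:R * \sum_y p y * \sum_x P x y * (M x y * N x y)| <=
  n%:R * (a * (\sum_y p y * \sum_x P x y * (M x y * M x y) +
               \sum_y p y * \sum_x P x y * (N x y * N x y))) +
  (C * C / a + C * C).
Proof.
move=> M N tP p0 p1 pP PM PN fC hC a0.
have exp2 A B := expectation_martingale (M := A) (N := B) n tP pP.
rewrite -exp2 // -sumrB.
have -> : n%:R * (a * (\sum_y p y * (\sum_x P x y * (M x y * M x y)) +
               \sum_y p y * (\sum_x P x y * (N x y * N x y)))) + (C * C / a + C * C) =
  \sum_(w : {ffun 'I_n.+1 -> X}) markov_law P p w *
    (a * (edge_sum M w * edge_sum M w + edge_sum N w * edge_sum N w) + (C * C / a + C * C)).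
  transitivity (a * (
      \sum_(w : {ffun 'I_n.+1 -> X}) markov_law P p w * (edge_sum M w * edge_sum M w) +
      \sum_(w : {ffun 'I_n.+1 -> X}) markov_law P p w * (edge_sum N w * edge_sum N w)) +
      (\sum_(w : {ffun 'I_n.+1 -> X}) markov_law P p w) * (C * C / a + C * C)).
    by rewrite !exp2 // (markov_law_mass n pP p1) mul1r -mulrDr mulrCA.
  rewrite mulr_suml -big_split mulr_sumr -big_split /=; apply: eq_bigr => w _.
  by move: (markov_law _ _ _) (edge_sum M w) (edge_sum N w) (C * C / a) => *; ring.
apply: (le_trans (ler_norm_sum _ _ _)); apply: ler_sum => w _.
have L0 : 0 <= markov_law P p w by apply: markov_law_ge0 => //; case: tP.
rewrite -mulrBr normrM (ger0_norm L0); apply: ler_wpM2l => //.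
by rewrite (edge_sum_score G s f) (edge_sum_score H t h); apply: product_perturbation.
Qed.

(** * Mean and covariance of the empirical mean *)

Lemma oscillation_bounded (R : realType) (X : finType) (d : nat) (f : 'I_d -> X -> R) :
  exists C, 0 <= C /\ forall j x y, `|f j x - f j y| <= C.
Proof.
exists (\sum_j \sum_x `|f j x| *+ 2); split.
  by rewrite sumr_ge0 // => j _; rewrite sumr_ge0 // => x _; rewrite mulrn_wge0.
move=> j x y; apply: (le_trans (ler_normB _ _)).
have B z : `|f j z| <= \sum_x `|f j x|.
  by rewrite (bigD1 z) //= lerDl sumr_ge0.
rewrite (bigD1 j) //= sumrMnl mulr2n -addrA.
apply: lerD => //; apply: (le_trans (B y)); rewrite lerDl sumr_ge0 // => k _.
by rewrite sumr_ge0 // => z _; rewrite mulrn_wge0.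
Qed.

Lemma mean_empirical_mean (R : realType) (X : finType) (d : nat) (P : X -> X -> R)
    (p : X -> R) (g : 'I_d -> X -> X -> R) (n : nat) :
  transition_matrix P -> (forall x, apply_col P p x = p x) -> (0 < n)%N ->
  mean (markov_law P p (n := n)) (empirical_mean g n) =
  \row_j \sum_y p y * \sum_x P x y * g j x y.
Proof.
move=> tP pP n0; apply/rowP => j; rewrite /mean summxE mxE.
have nn0 : (n%:R : R) != 0 by rewrite pnatr_eq0 -lt0n.
apply: (mulfI nn0); rewrite -(expectation_edge_sum (g j) n tP pP) mulr_sumr.
apply: eq_bigr => w _; rewrite !mxE mulrCA.
by rewrite mulVKf.
Qed.

Theorem mainTheorem8 (R : realType) (X : finType) (d : nat)
    (W : X -> X -> R) (g : 'I_d -> X -> X -> R)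
    (hW : transition_matrix W) (hirr : irreducible W)
    (hg : lin_indep_under W g) :
  (forall (n : nat) (theta : 'rV[R]_d), (0 < n)%N ->
     mean (stationary_law W g theta n) (empirical_mean g n) =
     expectation_param W g theta) /\
  (forall theta : 'rV[R]_d,
     (fun n : nat => cov_mx (stationary_law W g theta n)
                            (empirical_mean g n)) =
     (fun n : nat => n%:R^-1 *: hessian (potential W g) theta)
     +o_ \oo (fun n : nat => n%:R^-1 : R)).
Proof.
have cW : connected_support W by apply: irreducible_connected => //; case: hW.
(* Over an empty [X] every combination is vacuously of the form excluded by linear independence, so
   an index [j] guarantees a state. *)
have X0 (j : 'I_d) : exists x0 : X, True.
  have [x0 _|X0] := pickP (@predT X); first by exists x0.
  have [|] := hg (delta_mx 0 j); last first.
    by exists (fun=> 0), 0 => x; have := X0 x.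
  by apply/eqP => /rowP/(_ j)/eqP; rewrite !mxE !eqxx oner_eq0.
have meanE n theta : (0 < n)%N -> mean (stationary_law W g theta n) (empirical_mean g n) =
    expectation_param W g theta.
  move=> n0; apply/rowP => j; have [x0 _] := X0 j.
  have [tP cP] := exp_family_transition g theta x0 hW cW.
  have [p0 p1 pP] := stationaryP x0 tP cP.
  by rewrite (mean_empirical_mean g tP pP n0) !mxE (potential_gradient g theta j x0 hW cW).
split=> // theta; apply/eqaddoP => e e0.
(* The matrix norm is a maximum over finitely many entries, so eventual bounds on the single entries
   can be combined. *)
suff : \forall n \near \oo, forall jk : 'I_d * 'I_d,
  `|cov_mx (stationary_law W g theta n) (empirical_mean g n) jk.1 jk.2 -
    n%:R^-1 * hessian (potential W g) theta jk.1 jk.2| <= e * `|n%:R^-1 : R|.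
  apply: filterS => n h.
  rewrite /Num.norm /= mx_normrE; apply: bigmax_le => [|jk _].
    by rewrite mulr_ge0 ?normr_ge0 // ltW.
  by have := h jk; rewrite !mxE.
apply: filter_forall => -[j k] /=.
have [x0 _] := X0 j.
have [tP cP] := exp_family_transition g theta x0 hW cW.
have [p0 p1 pP] := stationaryP x0 tP cP.
have [f] := potential_hessian g theta x0 hW cW.
set m := (fun j x y => _) => -[Pm HE].
have [C [C0 fC]] := oscillation_bounded f.
set H := hessian _ _ in HE *.
have H0 i : 0 <= H i i.
  rewrite HE sumr_ge0 // => y _; rewrite mulr_ge0 ?(ltW (p0 _)) // sumr_ge0 // => x _.
  by rewrite mulr_ge0 ?(proj1 tP) // -expr2 sqr_ge0.
pose K := H j j + H k k.
have K0 : 0 <= K by rewrite addr_ge0.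
(* This weight gives [a * K <= e / 2], with [K + 1] keeping the denominator positive. The constant
   [B] uses the other half of [e] once [n] is large. *)
pose a := e / (2 * (K + 1)).
have K1 : 0 < 2 * (K + 1) by rewrite mulr_gt0 // ltr_wpDl.
have a0 : 0 < a by rewrite divr_gt0.
pose B := C * C / a + C * C.
have aK : a * K <= e / 2.
  rewrite /a -mulrA ler_wpM2l ?(ltW e0) // invfM -mulrA ler_piMr ?invr_ge0 //.
  by rewrite mulrC ler_pdivrMr ?mul1r ?lerDl // ltr_wpDl.
near=> n.
have n0 : (0 < n)%N by near: n; exact: nbhs_infty_gt.
have nR : 0 < (n%:R : R) by rewrite ltr0n.
have nB : B <= n%:R * (e / 2).
  rewrite -ler_pdivrMr ?divr_gt0 //; near: n; exact: nbhs_infty_ger.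
rewrite mxE meanE //.
have cE (w : {ffun 'I_n.+1 -> X}) i : (empirical_mean g n w - expectation_param W g theta) 0 i =
    n%:R^-1 * (edge_sum (g i) w - n%:R * pderive i (potential W g) theta).
  by rewrite !mxE mulrBr mulKf // gt_eqF.
under eq_bigr do rewrite !cE.
(* Taking out the square of [n%:R^-1] reduces the claim to an error of at most [n%:R * e] for the
   covariance of the unnormalized sums. *)
have -> : \sum_w stationary_law W g theta n w *
     (n%:R^-1 * (edge_sum (g j) w - n%:R * pderive j (potential W g) theta) *
      (n%:R^-1 * (edge_sum (g k) w - n%:R * pderive k (potential W g) theta))) -
      n%:R^-1 * H j k = n%:R^-1 * n%:R^-1 * (\sum_w stationary_law W g theta n w *
     ((edge_sum (g j) w - n%:R * pderive j (potential W g) theta) *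
      (edge_sum (g k) w - n%:R * pderive k (potential W g) theta)) - n%:R * H j k).
  rewrite mulrBr; congr (_ - _); last by rewrite -mulrA mulKf // gt_eqF.
  rewrite mulr_sumr; apply: eq_bigr => w _.
  move: (stationary_law _ _ _ _ _) (edge_sum (g j) w - _) (edge_sum (g k) w - _) => L u v.
  by move: (n%:R^-1 : R) => z; ring.
have ni0 : 0 < (n%:R^-1 : R) by rewrite invr_gt0.
rewrite normrM (gtr0_norm ni0) (gtr0_norm (mulr_gt0 ni0 ni0)).
rewrite [e * _]mulrC -mulrA ler_pM2l // ler_pdivrMl //.
have := edge_sum_covariance_bound n tP (fun x => ltW (p0 x)) p1 pP (Pm j) (Pm k) (fC j) (fC k) a0.
rewrite -!HE -/K -/B => /le_trans; apply.
apply: (@le_trans _ _ (n%:R * (e / 2) + n%:R * (e / 2))).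
  by rewrite lerD // ler_wpM2l // ltW.
by rewrite -mulrDr -splitr.
Unshelve. all: by end_near. Qed.
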